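(* Let $R_1,R_2\in\bar S$ be non-overlapping with sum $R_3=R_1+R_2$, and let the upper and lower Burkill integrals of $g(I)$ over $R_3$ with respect to $F$ be finite. Then (a) $$(F)\overline{\int}_{R_3} g(I)\le (F)\overline{\int}_{R_1} g(I)+(F)\overline{\int}_{R_2} g(I)+\sum_{y\in FR_1\cap FR_2} b(y;F),$$ (b) $$(F)\underline{\int}_{R_3} g(I)\ge (F)\underline{\int}_{R_1} g(I)+(F)\underline{\int}_{R_2} g(I)-\sum_{y\in FR_1\cap FR_2} b(y;F).$$ Similar results hold for norm-limits: if the upper and lower norm-limits over $R_3$ with respect to $G$ are finite, then (a) and (b) hold with $(F)\overline{\int},(F)\underline{\int},b(y;F)$ replaced by $(N;G)\overline{\int},(N;G)\underline{\int},c(y;G)$.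
   Context: Fix real $A<B$ and $W=[A,B]$. An interval is any of $(a,b),[a,b),(a,b],[a,b]$ with $A\le a<b\le B$; its length is $mI=b-a$. Two intervals (or sets) overlap if they have a non-degenerate interval in common. An $I^\sigma$ is a finite union of intervals; $+$ between sets denotes union. $E'$ is the derived set of $E$, and $FE=E'\cap(W\setminus E)'$ is the frontier of a set $E\subset W$ (not to be confused with the family $F$). $S$ is a fixed non-empty set of intervals and $g:S\to\mathbb R$. $\bar S$ is the collection of all $I^\sigma$ which are finite unions of points of $W$ and interiors of intervals of $S$. A division $D$ of an $I^\sigma$ $R$ is a finite set of pairwise non-overlapping intervals of $S$ (each with its own end-point brackets), the union of whose closures is $R'$; norm$(D)$ is the greatest length of its intervals; the end-points of its intervals are its division-points; $(R;D)\sum g(I)$ is the sum of $g(I)$ over the intervals of $D$. A Riemann succession of divisions of $R$ is a sequence $\{D_n\}$ of divisions of $R$ with norm$(D_n)\to0$. $D^{(1)}+D^{(2)}$ is the division formed by all the intervals of the divisions $D^{(1)},D^{(2)}$ of two non-overlapping sets. $F$ is a family of Riemann successions of divisions of sets $R\in\bar S$ satisfying the axioms (i), (ii), (iii), (v), (vi), (vii): (i) for every $R\in\bar S$ there is at least one Riemann succession of divisions of $R$ in $F$; (ii) if $\{D_n\}\in F$ and $n_i\to\infty$ are integers, then $\{D_{n_i}\}\in F$; (iii) if $R_1,R_2\in\bar S$ are non-overlapping and $\{D_{1,n}\},\{D_{2,n}\}\in F$ are over $R_1,R_2$, then $\{D_{1,n}+D_{2,n}\}\in F$; (v) if $R\in\bar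 S$ is the sum of non-overlapping $R_1,\dots,R_m\in\bar S$ such that every division $D$ of $R$ can be divided up into divisions $D^{(i)}$ of $R_i$ ($i=1,\dots,m$), and if $\{D_n\}\in F$ is over $R$, then $\{D^{(i)}_n\}\in F$ for each $i$; (vi) and (vii) are given below. $G$ is the set of all divisions occurring in successions of $F$. Upper/lower Burkill integrals: $(F)\overline{\int}_R g$ is the supremum of $\overline{\lim}_n(R;D_n)\sum g(I)$, and $(F)\underline{\int}_R g$ the infimum of $\underline{\lim}_n(R;D_n)\sum g(I)$, over all $\{D_n\}\in F$ of divisions of $R$. Upper norm-limit: $(N;G)\overline{\int}_R g=\lim_{e\to0}\sup\{(R;D)\sum g(I): D\in G \text{ a division of }R,\ \mathrm{norm}(D)<e\}$; the lower norm-limit $(N;G)\underline{\int}_R g$ is the same with $\inf$. Condition (a) for a point $x$ inside an interval $I\in\bar S$: $I=I_1+I_2+\{x\}$ where $I_1,I_2\in\bar S$ are intervals with common end-point $x$. A splitting at $x$ of a division $D$ of $I$ is a pair $(D_1,D_2)$ of divisions of $I_1,I_2$ such that: if $x$ is a division-point of $D$, then $D_1+D_2=D$; if $x$ is inside an interval $J$ of $D$, then $D_1+D_2$ consists of all intervals of $D$ other than $J$ (same brackets), together with one interval $J_1$ of $D_1$ and one interval $J_2$ of $D_2$ with $J_1'+J_2'=J'$. Axiom (vi): for every interval $I\in\bar S$, every $x$ satisfying (a) and every $\{D_n\}\in F$ over $I$, there are splittings $(D_{1,n},D_{2,n})$ of $D_n$ at $x$ with $\{D_{1,n}\}\in F$,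 $\{D_{2,n}\}\in F$. Axiom (vii): if $R_1,R_2\in\bar S$ and $R_1\subset R_2$ then $R_2-R_1'$ (if non-empty) is in $\bar S$. For $x$ satisfying (a) and $\{D_n\}\in F$ over $I$ such that $x$ is a division-point of only finitely many $D_n$, $B(x;\{D_n\})=\overline{\lim}_n|g(J_n)-g(J_{1,n})-g(J_{2,n})|$, where $J_n,J_{1,n},J_{2,n}$ are the intervals $J,J_1,J_2$ of the splittings as in (vi) (least upper bound over all such splittings if there are several). $b(x;I;F)$ is the supremum of $B(x;\{D_n\})$ over all such $\{D_n\}$ ($0$ if there are none). $C(x;G;e)$ is the supremum of $|g(J)-g(J_1)-g(J_2)|$ over all $D\in G$ over $I$ with norm$(D)<e$ and $x$ inside an interval $J$ of $D$, and all splittings of $D$ at $x$ with $D_1,D_2\in G$ ($0$ if there are none), and $c(x;I;G)=\lim_{e\to0}C(x;G;e)$. Under (vi) and (vii) these do not depend on $I$ and are written $b(x;F)$, $c(x;G)$. (Each point of $FR_1\cap FR_2$ satisfies (a) for a suitable $I$.)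
   Formalization: The values b(y;I;F) and c(y;I;G) need not be independent of I as claimed, so b(y;F) and c(y;G) are taken as the suprema of b(y;I;F) and c(y;I;G) over all I for which y satisfies condition (a); this is the common value whenever they do not depend on I. *)

(* Defs.v *)
From mathcomp Require Import all_boot all_order all_algebra.
From mathcomp Require Import finmap.
From mathcomp Require Export all_classical all_reals all_analysis.
Import Order.TTheory GRing.Theory Num.Theory.
Import numFieldNormedType.Exports.

Set Implicit Arguments.
Unset Strict Implicit.
Unset Printing Implicit Defensive.

Local Open Scope classical_set_scope.
Local Open Scope ring_scope.

(* Point sets are of type [set R].  The intervals that are arguments of g and
   members of divisions are terms [J : interval R], whose point set is [set` J];
   on non-degenerate bounded intervals this correspondence is one-to-one, so a
   family of intervals is a [set (interval R)] and a division is a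
   [{fset interval R}].  The derived set of E is the library's [limit_point E],
   and the topological interior of E is written [E°]. *)

Section Intervals.
Variable R : realType.
Local Notation succession := (nat -> {fset interval R}).
Implicit Types (J : interval R) (D : {fset interval R}) (X Y : set R).

(* The values on unbounded intervals are never used. *)
Definition left_end J : R := if J.1 is BSide _ a then a else 0.
Definition right_end J : R := if J.2 is BSide _ b then b else 0.

Definition is_end (x : R) J : Prop := x = left_end J \/ x = right_end J.

Definition length J : R := right_end J - left_end J.

Definition norm D : R := \big[Num.max/0]_(J <- D) length J.

Definition division_point D (x : R) : Prop := exists2 J, J \in D & is_end x J.

Variables A B : R.

Definition W : set R := [set` `[A, B]%R].

Definition is_interval_of_W J : Prop :=
  if J is Interval (BSide _ a) (BSide _ b)
  then [/\ A <= a, a < b & b <= B] else False.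

Definition overlap X Y : Prop :=
  exists2 J, is_interval_of_W J & [set` J] `<=` X `&` Y.

(* A finite union of intervals is a union of at least one interval, so that it
   is non-empty. *)
Definition is_Isigma X : Prop :=
  exists T : set (interval R),
    [/\ finite_set T, T !=set0, T `<=` is_interval_of_W &
        X = \bigcup_(J in T) [set` J]].

Definition frontier X : set R := limit_point X `&` limit_point (W `\` X).

Variable S : set (interval R).

Definition Sbar X : Prop :=
  is_Isigma X /\
  exists (P : set R) (T : set (interval R)),
    [/\ finite_set P, P `<=` W, finite_set T, T `<=` S &
        X = P `|` \bigcup_(J in T) [set` J]°].

Definition Sbar_interval X : Prop :=
  Sbar X /\ exists2 J, is_interval_of_W J & X = [set` J].

Definition division X D : Prop :=
  [/\ forall J, J \in D -> S J,
      forall J K, J \in D -> K \in D -> J <> K -> ~ overlap [set` J] [set` K] &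
      \bigcup_(J in [set` D]) closure [set` J] = limit_point X].

Definition over X (D : succession) : Prop :=
  forall n, division X (D n).

Definition riemann_succession X (D : succession) : Prop :=
  over X D /\ norm (D n) @[n --> \oo] --> (0 : R).

(* Condition (a): I = I1 + I2 + {x}, with x inside the interval I. *)
Definition condition_a (x : R) (I I1 I2 : set R) : Prop :=
  [/\ Sbar_interval I, I° x, I = I1 `|` I2 `|` [set x], Sbar I1 /\ Sbar I2 &
      exists J1 J2,
        [/\ is_interval_of_W J1 /\ I1 = [set` J1],
            is_interval_of_W J2 /\ I2 = [set` J2] &
            is_end x J1 /\ is_end x J2]].

(* J is the interval of D that has x inside it, and it is replaced by J1 in D1
   and J2 in D2. *)
Definition cuts (x : R) D D1 D2 J J1 J2 : Prop :=
  [/\ J \in D /\ [set` J]° x, J1 \in D1, J2 \in D2,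
      (D1 `|` D2)%fset = ((D `\ J) `|` [fset J1; J2])%fset &
      limit_point [set` J1] `|` limit_point [set` J2] = limit_point [set` J]].

Definition splitting (x : R) (I1 I2 : set R) D D1 D2 : Prop :=
  [/\ division I1 D1, division I2 D2,
      division_point D x -> (D1 `|` D2)%fset = D &
      forall J, J \in D -> [set` J]° x ->
        exists J1 J2, cuts x D D1 D2 J J1 J2].

(* Successions are not tagged by the set that they divide: a sequence of
   divisions of X is also one of every set with the same derived set as X. *)
Record burkill_family (F : set (succession)) : Prop := {
  family_succession : forall D : succession, F D ->
    exists2 X, Sbar X & riemann_succession X D;
  axiom_i : forall X, Sbar X -> exists2 D : succession, F D & over X D;
  axiom_ii : forall (D : succession) (s : nat -> nat), F D ->
    s n @[n --> \oo] --> \oo -> F (fun n => D (s n));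
  axiom_iii : forall X1 X2 (D1 D2 : succession), Sbar X1 -> Sbar X2 -> ~ overlap X1 X2 ->
    F D1 -> F D2 -> over X1 D1 -> over X2 D2 ->
    F (fun n => (D1 n `|` D2 n)%fset);
  axiom_v : forall X (m : nat) (Xs : 'I_m -> set R),
    Sbar X -> (forall i, Sbar (Xs i)) ->
    (forall i j, i <> j -> ~ overlap (Xs i) (Xs j)) ->
    X = \bigcup_i Xs i ->
    (forall D, division X D ->
      exists Ds : 'I_m -> {fset interval R},
        (forall i, division (Xs i) (Ds i)) /\
        D = (\bigcup_(i <- enum 'I_m) Ds i)%fset) ->
    forall (D : succession)
           (Ds : 'I_m -> succession),
      F D -> over X D ->
      (forall i, over (Xs i) (Ds i)) ->
      (forall n, D n = (\bigcup_(i <- enum 'I_m) Ds i n)%fset) ->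
      forall i, F (Ds i);
  axiom_vi : forall x I I1 I2, condition_a x I I1 I2 ->
    forall D : succession, F D -> over I D ->
      exists D1 D2 : succession,
        [/\ F D1, F D2 & forall n, splitting x I1 I2 (D n) (D1 n) (D2 n)];
  axiom_vii : forall X1 X2, Sbar X1 -> Sbar X2 -> X1 `<=` X2 ->
    X2 `\` limit_point X1 !=set0 -> Sbar (X2 `\` limit_point X1)
}.

(* The set G of all the divisions that occur in successions of F. *)
Definition occurring (F : set (succession)) :
    set {fset interval R} :=
  [set D | exists2 Ds, F Ds & exists n, D = Ds n].

(* Only the values of g on S are used. *)
Variable g : interval R -> R.

Definition rsum D : R := \sum_(J <- D) g J.

Definition split_error J J1 J2 : R := `|g J - g J1 - g J2|.

Local Open Scope ereal_scope.

Section Family.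
Variable F : set (succession).

Definition upper_integral X : \bar R :=
  ereal_sup [set limn_esup (fun n => (rsum (D n))%:E) |
             D in [set D : succession | F D /\ over X D]].

Definition lower_integral X : \bar R :=
  ereal_inf [set limn_einf (fun n => (rsum (D n))%:E) |
             D in [set D : succession | F D /\ over X D]].

(* B(x; {D_n}), for D over I = I1 + I2 + {x}: J n, J1 n and J2 n are constrained
   for all large n only, since x may be a division-point of finitely many
   D n. *)
Definition split_limsup (x : R) (I1 I2 : set R) (D : succession) :
    \bar R :=
  ereal_sup [set v | exists (D1 D2 : succession)
                            (J J1 J2 : nat -> interval R),
    [/\ F D1, F D2,
        forall n, splitting x I1 I2 (D n) (D1 n) (D2 n),
        \forall n \near \oo,
          cuts x (D n) (D1 n) (D2 n) (J n) (J1 n) (J2 n) &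
        v = limn_esup (fun n => (split_error (J n) (J1 n) (J2 n))%:E)]].

(* b(x; I; F); the maximum with 0 only matters if there is no such D. *)
Definition b_on (x : R) (I : set R) : \bar R :=
  maxe 0 (ereal_sup [set v | exists (D : succession) I1 I2,
    [/\ condition_a x I I1 I2, F D, over I D,
        \forall n \near \oo, ~ division_point (D n) x &
        v = split_limsup x I1 I2 D]]).

(* b(x; F): the value of b(x; I; F), which is meant not to depend on I, is
   written without reference to I as the supremum over the intervals I for which
   x satisfies condition (a). *)
Definition b_family (x : R) : \bar R :=
  ereal_sup [set b_on x I | I in [set I | exists I1 I2, condition_a x I I1 I2]].

End Family.

Section Norm_limits.
Variable G : set {fset interval R}.

Definition upper_norm_limit X : \bar R :=
  lim (ereal_sup [set (rsum D)%:E |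
         D in [set D | [/\ G D, division X D & (norm D < e)%R]]]
       @[e --> (0%R : R)^'+]).

Definition lower_norm_limit X : \bar R :=
  lim (ereal_inf [set (rsum D)%:E |
         D in [set D | [/\ G D, division X D & (norm D < e)%R]]]
       @[e --> (0%R : R)^'+]).

(* C(x; G; e), for divisions over I. *)
Definition C_on (x : R) (I : set R) (e : R) : \bar R :=
  maxe 0 (ereal_sup [set v | exists D D1 D2 I1 I2 J J1 J2,
    [/\ condition_a x I I1 I2,
        [/\ G D, division I D & (norm D < e)%R],
        [/\ G D1, G D2 & splitting x I1 I2 D D1 D2],
        cuts x D D1 D2 J J1 J2 &
        v = (split_error J J1 J2)%:E]]).

Definition c_on (x : R) (I : set R) : \bar R :=
  lim (C_on x I e @[e --> (0%R : R)^'+]).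

(* c(x; G), with the same convention as for b(x; F). *)
Definition c_family (x : R) : \bar R :=
  ereal_sup [set c_on x I | I in [set I | exists I1 I2, condition_a x I I1 I2]].

End Norm_limits.
End Intervals.

(* Main.v *)
Require Import Defs.
From mathcomp Require Import all_boot all_order all_algebra.
From mathcomp Require Import finmap.
From mathcomp Require Import all_classical all_reals all_analysis.
From mathcomp Require Import lra.
Import Order.TTheory GRing.Theory Num.Theory.
Import numFieldNormedType.Exports.

Set Implicit Arguments.
Unset Strict Implicit.
Unset Printing Implicit Defensive.

Local Open Scope classical_set_scope.
Local Open Scope ring_scope.

(** A set X in Sbar enters the integrals, the norm-limits and the notion of
    division only through its derived set, and this derived set is a finite
    union of disjoint closed intervals, each of which is itself in Sbar
    ([Sbar_components]).  Listed together from left to right, the components of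
    R1' and of R2' form a chain of closed intervals with disjoint interiors
    ([merged_components]).  Consecutive intervals of the chain are separated by
    a gap or touch at a point, and the points of contact are exactly the points
    of FR1 and FR2 in common ([frontier_shared]).

    A succession over R1 + R2 is broken up along the chain, from the left.  At a
    gap, axiom (v) separates the two sides at no cost.  At a point of contact y,
    the interval of the remaining set around y is first isolated by (v), then
    cut at y by (vi), and its right half is put back together with the rest by
    (iii) ([split_head], [chain_splitting]).  Such a cut changes the sum of g
    only if y lies inside an interval J of the division, and then by
    g(J) - g(J1) - g(J2), which is asymptotically at most b(y;F) or c(y;G).  The
    pieces that belong to R1 and those that belong to R2 are reassembled by
    (iii) ([family_gather]), so that every sum over R1 + R2 is at most a sum
    over R1 plus a sum over R2 plus the errors of the cuts ([pair_splitting]).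

    The two halves of the theorem differ in how the error of one cut is
    controlled.  For the Burkill integrals one passes to a subsequence along
    which y is always a division-point, or never is and the error stays below a
    given bound exceeding b(y;F) ([cuts_near_family]).  For the norm-limits the
    bound must hold for one given division, so that no subsequence is taken, but
    it holds for all divisions of small norm ([cuts_near_norm]).  The lemmas on
    chains are therefore stated for a class T of admissible reindexings.

    Finiteness over R1 + R2 prevents the upper integral over R1 or over R2 from
    being -oo, since otherwise adding a fixed succession over the other set
    would make the lower integral over R1 + R2 equal to -oo
    ([upper_integral_gtNy], [upper_norm_gtNy]).  Hence the right-hand side of
    (a) is never of the form -oo + oo.  Statement (b) is (a) for - g. *)

(** * Derived sets of intervals *)
Section Derived_sets.
Variable R : realType.
Implicit Types (X Y : set R) (x l r : R).

(** Order intervals are the convenient neighbourhoods here, because the sets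
    considered are unions of intervals. *)
Lemma limit_point_itvP X x :
  limit_point X x <->
  forall l r, l < x < r -> exists y, [/\ X y, y != x & l < y < r].
Proof.
split=> [Xx l r lxr|Xx U].
  have : nbhs x `]l, r[%classic.
    by apply: open_nbhs_nbhs; split; [exact: interval_open|rewrite /= in_itv].
  by move=> /Xx[y [yx Xy]]; rewrite /= in_itv/= => lyr; exists y.
move=> /nbhs_ballP[e /= e0 eU].
have [|y [Xy yx lyr]] := Xx (x - e) (x + e).
  by rewrite ltrBlDr ltrDl e0 /=.
by exists y; split => //; apply: eU; rewrite /ball/= ltr_distlC.
Qed.

Lemma limit_pointS X Y : X `<=` Y -> limit_point X `<=` limit_point Y.
Proof. by move=> XY x Xx U /Xx[y [? /XY ? ?]]; exists y. Qed.

Lemma limit_pointU X Y :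
  limit_point (X `|` Y) = limit_point X `|` limit_point Y.
Proof.
apply/seteqP; split=> [x XYx|x [|]]; last 2 first.
- by apply: limit_pointS => y; left.
- by apply: limit_pointS => y; right.
apply: contrapT => /not_orP[].
move=> /limit_point_itvP/existsNP[l1] /existsNP[r1] /not_implyP[/andP[l1x xr1] N1].
move=> /limit_point_itvP/existsNP[l2] /existsNP[r2] /not_implyP[/andP[l2x xr2] N2].
have [|y [XYy yx]] := (limit_point_itvP _ _).1 XYx (Num.max l1 l2) (Num.min r1 r2).
  by rewrite gt_max lt_min l1x l2x xr1 xr2.
rewrite gt_max lt_min => /andP[/andP[l1y l2y] /andP[yr1 yr2]].
case: XYy => [Xy|Yy]; [apply: N1|apply: N2]; exists y.
  by rewrite l1y yr1.
by rewrite l2y yr2.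
Qed.

Lemma limit_point_finite X : finite_set X -> limit_point X = set0.
Proof.
move=> finX; apply/seteqP; split => // x /limit_point_infinite_setP/(_ setT).
by case; [exact: filterT|rewrite setTI].
Qed.

Lemma limit_point_between_itv X l r : l < r ->
  `]l, r[ `<=` X -> X `<=` `[l, r] -> limit_point X = `[l, r]%classic.
Proof.
move=> lr lrX Xlr; apply/seteqP; split=> x.
  move/limit_point_itvP => Xx; rewrite /= in_itv/= !leNgt; apply/andP; split.
    apply/negP => xl; have [|y [/Xlr]] := Xx (x - 1) l; first by lra.
    by rewrite /= in_itv/=; lra.
  apply/negP => rx; have [|y [/Xlr]] := Xx r (x + 1); first by lra.
  by rewrite /= in_itv/=; lra.
rewrite /= in_itv/= => /andP[lx xr]; apply/limit_point_itvP => a b /andP[ax xb].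
have mid u v : Num.max l a <= u -> v <= Num.min r b -> u < v ->
    u = x \/ v = x -> exists y, [/\ X y, y != x & a < y < b].
  rewrite ge_max le_min => /andP[lu au] /andP[vr vb] uv uvx.
  have [uz zv] := midf_lt uv; exists ((u + v) / 2); split.
  - apply: lrX; rewrite /= in_itv/=; lra.
  - by case: uvx => <-; rewrite ?(gt_eqF uz) ?(lt_eqF zv).
  - lra.
have [xltr|rlex] := ltP x r.
  apply: (mid x (Num.min r b)); [| |by rewrite lt_min xltr|by left] => //.
  by rewrite ge_max lx ltW.
have xr' : x = r by apply/eqP; rewrite eq_le xr rlex.
apply: (mid (Num.max l a) x); [| | |by right] => //.
  by rewrite le_min xr ltW.
by rewrite gt_max ax xr' lr.
Qed.

Lemma closure_between_itv X l r : l < r ->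
  `]l, r[ `<=` X -> X `<=` `[l, r] -> closure X = `[l, r]%classic.
Proof.
move=> lr lrX Xlr; rewrite closure_isolated_limit_point.
rewrite (limit_point_between_itv lr lrX Xlr) setUidr//.
by move=> x /isolatedS/Xlr.
Qed.

Lemma interior_between_itv X l r :
  `]l, r[ `<=` X -> X `<=` `[l, r] -> X° = `]l, r[%classic.
Proof.
move=> lrX Xlr; apply/seteqP; split; last first.
  by rewrite -open_subsetE//; exact: interval_open.
by move=> x /(interiorS Xlr); rewrite interior_itv.
Qed.

Lemma interval_of_W_ends (A B : R) J : is_interval_of_W A B J ->
  [/\ left_end J < right_end J, A <= left_end J, right_end J <= B,
      `]left_end J, right_end J[ `<=` [set` J] &
      [set` J] `<=` `[left_end J, right_end J]].
Proof.
case: J => -[b1 a|//] -[b2 b|//] /= [Aa ab bB]; split=> //; apply: subset_itv;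
  by rewrite bnd_simp.
Qed.

Section W_intervals.
Variables (A B : R) (J : interval R).
Hypothesis WJ : is_interval_of_W A B J.

Lemma interval_limit_point :
  limit_point [set` J] = `[left_end J, right_end J]%classic.
Proof. by have [? _ _ ? ?] := interval_of_W_ends WJ; exact: limit_point_between_itv. Qed.

Lemma interval_closure : closure [set` J] = `[left_end J, right_end J]%classic.
Proof. by have [? _ _ ? ?] := interval_of_W_ends WJ; exact: closure_between_itv. Qed.

Lemma interval_interior : [set` J]° = `]left_end J, right_end J[%classic.
Proof. by have [_ _ _ ? ?] := interval_of_W_ends WJ; exact: interior_between_itv. Qed.

Lemma interval_ends_lt : left_end J < right_end J.
Proof. by have [] := interval_of_W_ends WJ. Qed.

End W_intervals.

End Derived_sets.

(** * Components of the members of Sbar *)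
Section Components.
Variables (R : realType) (A B : R) (S : set (interval R)).
Hypothesis SW : S `<=` is_interval_of_W A B.
Implicit Types (X Y : set R) (p q : R * R) (L : seq (R * R)).

(** A pair p stands for the closed interval [p.1, p.2], and a list of pairs for
    the union of its intervals. *)
Definition covered L : set R := [set x | exists2 p, p \in L & p.1 <= x <= p.2].

Definition Sbar_itv p : Prop :=
  is_interval_of_W A B `[p.1, p.2] /\ Sbar A B S `[p.1, p.2]%classic.

Definition before p q : bool := p.2 <= q.1.
Definition strictly_before p q : bool := p.2 < q.1.

Lemma Sbar_itv_lt p : Sbar_itv p -> p.1 < p.2.
Proof. by case=> -[]. Qed.

Lemma covered_nil : covered [::] = set0.
Proof. by apply/seteqP; split => // x []. Qed.

Lemma covered_cat L L' : covered (L ++ L') = covered L `|` covered L'.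
Proof.
apply/seteqP; split => [x [p]|x [] [p pL px]].
- by rewrite mem_cat => /orP[pL px|pL px]; [left|right]; exists p.
- by exists p; rewrite // mem_cat pL.
- by exists p; rewrite // mem_cat pL orbT.
Qed.

Lemma covered1 p : covered [:: p] = `[p.1, p.2]%classic.
Proof.
apply/seteqP; split=> x; first by case=> q; rewrite inE => /eqP->; rewrite /= in_itv.
by rewrite /= in_itv/= => px; exists p; rewrite ?inE.
Qed.

Lemma covered_cons p L : covered (p :: L) = `[p.1, p.2]%classic `|` covered L.
Proof. by rewrite -cat1s covered_cat covered1. Qed.

Lemma covered_perm L L' : perm_eq L L' -> covered L = covered L'.
Proof.
by move=> LL'; apply/seteqP; split => x [p pL px]; exists p => //;
  rewrite ?(perm_mem LL') // -(perm_mem LL').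
Qed.

(** A finite union of non-degenerate closed intervals is perfect. *)
Lemma covered_limit_point L :
  (forall p, p \in L -> p.1 < p.2) -> limit_point (covered L) = covered L.
Proof.
elim: L => [|p L IH] pL; first by rewrite covered_nil limit_point_finite.
rewrite covered_cons limit_pointU IH => [|q qL]; last first.
  by apply: pL; rewrite inE qL orbT.
congr (_ `|` _); apply: limit_point_between_itv => //.
  by apply: pL; rewrite mem_head.
by apply: subset_itv; rewrite bnd_simp.
Qed.

Lemma SbarU X Y : Sbar A B S X -> Sbar A B S Y -> Sbar A B S (X `|` Y).
Proof.
move=> [[T1 [fT1 T1n T1W ->]] [P1 [U1 [fP1 P1W fU1 U1S E1]]]].
move=> [[T2 [fT2 T2n T2W ->]] [P2 [U2 [fP2 P2W fU2 U2S E2]]]].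
split; first exists (T1 `|` T2).
  split.
  - by rewrite finite_setU.
  - by case: T1n => J ?; exists J; left.
  - by move=> J [/T1W|/T2W].
  - by rewrite bigcup_setU.
exists (P1 `|` P2), (U1 `|` U2); split.
- by rewrite finite_setU.
- by move=> J [/P1W|/P2W].
- by rewrite finite_setU.
- by move=> J [/U1S|/U2S].
- by rewrite bigcup_setU E1 E2 setUACA.
Qed.

(** A member of Sbar, being a union of non-degenerate intervals, has no isolated
    point. *)
Lemma Sbar_subset_limit_point X : Sbar A B S X -> X `<=` limit_point X.
Proof.
move=> [[T [_ _ TW ->]] _] x [J TJ Jx].
suff : limit_point [set` J] x by apply: limit_pointS => y; exists J.
rewrite (interval_limit_point (TW _ TJ)).
by have [_ _ _ _] := interval_of_W_ends (TW _ TJ); apply.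
Qed.

Lemma Sbar_nonempty X : Sbar A B S X -> X !=set0.
Proof.
move=> [[T [_ [J TJ] TW ->]] _]; have [lr _ _ I _] := interval_of_W_ends (TW _ TJ).
exists ((left_end J + right_end J) / 2), J => //; apply: I.
by rewrite /= in_itv/=; lra.
Qed.

(** The interior of J and the two ends of J exhibit the closure of J as a member
    of Sbar. *)
Lemma Sbar_itv_ends J : S J -> Sbar_itv (left_end J, right_end J).
Proof.
move=> SJ; have WJ := SW SJ; have [lr Al rB I I'] := interval_of_W_ends WJ.
split; first by split.
split.
  exists [set Interval (BLeft (left_end J)) (BRight (right_end J))]; split.
  - exact: finite_set1.
  - by exists (`[left_end J, right_end J]).
  - by move=> _ ->; split.
  - by rewrite bigcup_set1.
exists [set left_end J; right_end J], [set J]; split.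
- exact: finite_set2.
- by move=> x [] ->; rewrite /W /= in_itv/=; lra.
- exact: finite_set1.
- by move=> _ ->.
rewrite bigcup_set1 (interval_interior WJ); apply/seteqP; split => x /=.
  rewrite !in_itv/= => /andP[lx xr].
  have [->|xl] := eqVneq x (left_end J); first by left; left.
  have [->|xr'] := eqVneq x (right_end J); first by left; right.
  by right; rewrite lt_neqAle eq_sym xl lx lt_neqAle xr'.
by rewrite !in_itv/= => -[[->|->]|]; lra.
Qed.

Lemma Sbar_itv_merge p q : Sbar_itv p -> Sbar_itv q -> q.1 <= p.2 -> p.1 <= q.2 ->
  Sbar_itv (Num.min p.1 q.1, Num.max p.2 q.2) /\
  `[Num.min p.1 q.1, Num.max p.2 q.2]%classic =
    `[p.1, p.2]%classic `|` `[q.1, q.2]%classic.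
Proof.
move=> [[Ap pp pB] Sp] [[Aq qq qB] Sq] qp pq.
have E : `[Num.min p.1 q.1, Num.max p.2 q.2]%classic =
    `[p.1, p.2]%classic `|` `[q.1, q.2]%classic.
  apply/seteqP; split=> x /=; rewrite !in_itv/= ge_min le_max; last first.
    by move=> [/andP[-> ->]//|/andP[-> ->]]; rewrite !orbT.
  case: (leP p.1 x) => ?; case: (leP x p.2) => ?; case: (leP q.1 x) => ?;
    case: (leP x q.2) => ? //= _; first [by left|by right|exfalso; lra].
split=> //; split; last by rewrite /= E; exact: SbarU.
by split=> /=; rewrite ?le_min ?ge_max ?gt_min ?lt_max ?Ap ?pB ?pp.
Qed.

(** The intervals of L that meet the new interval are absorbed one after the
    other: the union of two intervals with a common point is again an interval
    in Sbar. *)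
Lemma insert_component p L :
  Sbar_itv p -> (forall q, q \in L -> Sbar_itv q) -> pairwise strictly_before L ->
  exists L', [/\ forall q, q \in L' -> Sbar_itv q, pairwise strictly_before L' &
    covered L' = `[p.1, p.2]%classic `|` covered L].
Proof.
elim: L p => [|q L IH] p gp gL sL.
  exists [:: p]; split=> //; first by move=> q; rewrite inE => /eqP ->.
  by rewrite covered1 covered_nil setU0.
have gq : Sbar_itv q by apply: gL; rewrite mem_head.
have {}gL r : r \in L -> Sbar_itv r by move=> rL; apply: gL; rewrite inE rL orbT.
move: sL; rewrite /= => /andP[/allP qL sL].
have [pq|qp] := ltP p.2 q.1.
  exists [:: p, q & L]; split.
  - by move=> r; rewrite !inE => /or3P[/eqP->|/eqP->|/gL].
  - rewrite /= sL /strictly_before pq /= andbT; apply/andP; split; apply/allP => // r rL.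
    by rewrite (lt_trans pq)// (lt_trans (Sbar_itv_lt gq))//; exact: qL.
  - by rewrite covered_cons.
have [{}pq|pq] := ltP q.2 p.1; last first.
  have [gm Em] := Sbar_itv_merge gp gq qp pq.
  have [L' [gL' sL' EL']] := IH _ gm gL sL.
  by exists L'; split=> //; rewrite EL' /= Em covered_cons setUA.
have [L' [gL' sL' EL']] := IH _ gp gL sL.
exists (q :: L'); split.
- by move=> r; rewrite inE => /predU1P[->//|/gL'].
- rewrite /= sL' andbT; apply/allP => r rL'.
  have : covered L' r.1 by exists r; rewrite // lexx (ltW (Sbar_itv_lt (gL' _ rL'))).
  rewrite EL' => -[|[s sL1 /andP[sr _]]]; last exact: lt_le_trans (qL _ sL1) _.
  by rewrite /= in_itv/= => /andP[pr _]; exact: lt_le_trans pr.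
- by rewrite !covered_cons EL' setUCA.
Qed.

(** The finitely many points of X contribute nothing to its derived set, so that
    the components arise by merging the closures of the intervals of S whose
    interiors make up X.  Strict separation matters: a point where two listed
    intervals of the same set touched would not belong to the frontier. *)
Lemma Sbar_components X : Sbar A B S X ->
  exists L, [/\ forall p, p \in L -> Sbar_itv p, pairwise strictly_before L &
    limit_point X = covered L].
Proof.
move=> [_ [P [T [fP _ /finite_seqP[s ->] TS ->]]]].
rewrite limit_pointU limit_point_finite// set0U.
elim: s TS => [|J s IH] TS.
  exists [::]; split => //.
  rewrite covered_nil [X in limit_point X](_ : _ = set0) ?limit_point_finite//.
  by apply/seteqP; split => x [] /=.
have [L [gL sL EL]] : exists L,
    [/\ forall p, p \in L -> Sbar_itv p, pairwise strictly_before L &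
        limit_point (\bigcup_(J in [set` s]) [set` J]°) = covered L].
  by apply: IH => K Ks; apply: TS; rewrite /= inE Ks orbT.
have SJ : S J by apply: TS; rewrite /= mem_head.
have [L' [gL' sL' EL']] := insert_component (Sbar_itv_ends SJ) gL sL.
exists L'; split=> //; rewrite EL' -EL.
have -> : [set` J :: s] = J |` [set` s].
  apply/seteqP; split => K /=; rewrite inE; first by move=> /predU1P.
  by move=> ?; apply/predU1P.
rewrite bigcup_setU1 limit_pointU (interval_interior (SW SJ)).
congr (_ `|` _); apply: limit_point_between_itv => //.
  exact: interval_ends_lt (SW SJ).
by apply: subset_itv; rewrite bnd_simp.
Qed.

Lemma Sbar_covered L : (forall p, p \in L -> Sbar_itv p) -> L != [::] ->
  Sbar A B S (covered L).
Proof.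
elim: L => // p [|q L] IH gL _.
  by rewrite covered1; case: (gL p); rewrite ?mem_head.
rewrite covered_cons; apply: SbarU; first by case: (gL p); rewrite ?mem_head.
by apply: IH => // r rL; apply: gL; rewrite inE rL orbT.
Qed.

End Components.

(** * Points of contact in a chain of intervals *)
Section Shared_points.
Variable R : realType.
Implicit Types (p q : R * R) (L : seq (R * R)).

(** In a chain, q.1 = p.2 holds only if q follows p immediately, so that these
    are the points where consecutive intervals touch. *)
Definition shared L : seq R := [seq p.2 | p <- L & p.2 \in [seq q.1 | q <- L]].

Lemma sharedP L y :
  reflect (exists p q, [/\ p \in L, q \in L, p.2 = y & q.1 = y]) (y \in shared L).
Proof.
apply: (iffP mapP) => [[p]|[p [q [pL qL py qy]]]].
  by rewrite mem_filter => /andP[/mapP[q qL pq] pL] yp; exists p, q; rewrite -pq yp.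
exists p => //; rewrite mem_filter pL andbT; apply/mapP; exists q => //.
by rewrite py qy.
Qed.

Section Chain.
Variables (p : R * R) (L : seq (R * R)).
Hypothesis ltL : forall q, q \in p :: L -> q.1 < q.2.
Hypothesis bL : pairwise (@before R) (p :: L).

Lemma chain_after q : q \in L -> p.2 <= q.1.
Proof. by move: bL; rewrite /= => /andP[/allP pL _] /pL. Qed.

Lemma chain_tail : (forall q, q \in L -> q.1 < q.2) /\ pairwise (@before R) L.
Proof.
by split=> [q qL|]; [apply: ltL; rewrite inE qL orbT|case/andP: bL].
Qed.

Lemma chain_lt : p.1 < p.2.
Proof. by apply: ltL; rewrite mem_head. Qed.

Lemma chain_head_notin : p \notin L.
Proof. by apply/negP => /chain_after; rewrite leNgt chain_lt. Qed.

Lemma shared_cons :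
  shared (p :: L) = if p.2 \in [seq q.1 | q <- L] then p.2 :: shared L else shared L.
Proof.
rewrite /shared /= inE gt_eqF ?chain_lt//=; set s := [seq q.1 | q <- L].
have -> : [seq q <- L | q.2 \in p.1 :: s] = [seq q <- L | q.2 \in s].
  apply: eq_in_filter => q qL; rewrite inE gt_eqF//.
  have := chain_after qL; have := chain_lt; have := chain_tail.1 _ qL; lra.
by case: ifP.
Qed.

Lemma shared_after y : y \in shared L -> p.2 < y.
Proof.
move=> /sharedP[q [r [qL rL <- _]]].
have := chain_after qL; have := chain_tail.1 _ qL; lra.
Qed.

End Chain.

Lemma chain_uniq L : (forall q, q \in L -> q.1 < q.2) -> pairwise (@before R) L ->
  uniq L /\ uniq (shared L).
Proof.
elim: L => // p L IH ltL bL; have [ltL' bL'] := chain_tail ltL bL.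
have [uL usL] := IH ltL' bL'; rewrite /= uL (chain_head_notin ltL bL) shared_cons//.
split=> //; case: ifP => //= _; rewrite usL andbT.
by apply/negP => /(shared_after ltL bL); rewrite ltxx.
Qed.

End Shared_points.

(** * The common frontier of two non-overlapping sets *)
Section Two_sets.
Variables (R : realType) (A B : R) (S : set (interval R)).
Implicit Types (X Y : set R) (p q : R * R) (L : seq (R * R)).

(** X is dense in its derived set, but may miss finitely many points of it; some
    open interval avoids them. *)
Lemma Sbar_open_part X l r : Sbar A B S X -> l < r ->
  `]l, r[ `<=` limit_point X ->
  exists l' r', [/\ l <= l', l' < r', r' <= r & `]l', r'[ `<=` X].
Proof.
move=> [[T [_ _ TW EX]] _] lr lrX.
have : limit_point X ((l + r) / 2) by apply: lrX; rewrite /= in_itv/=; lra.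
move=> /limit_point_itvP/(_ l r)[|z [Xz _ lzr]]; first by lra.
move: Xz; rewrite EX => -[J TJ Jz].
have [lrJ _ _ I I'] := interval_of_W_ends (TW _ TJ).
have := I' _ Jz; rewrite /= in_itv/= => zJ.
exists (Num.max l (left_end J)), (Num.min r (right_end J)); split.
- by rewrite le_max lexx.
- by rewrite gt_max !lt_min lr lrJ; lra.
- by rewrite ge_min lexx.
move=> x; rewrite /= in_itv/= gt_max lt_min => /andP[/andP[_ lx] /andP[_ xr]].
by exists J => //; apply: I; rewrite /= in_itv/= lx.
Qed.

(** Non-overlapping can thus be tested on derived sets: shrinking the interval
    once for X and once for Y puts it inside both. *)
Lemma overlap_limit_points X Y l r : Sbar A B S X -> Sbar A B S Y ->
  A <= l -> l < r -> r <= B ->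
  `]l, r[ `<=` limit_point X -> `]l, r[ `<=` limit_point Y -> overlap A B X Y.
Proof.
move=> SX SY Al lr rB lrX lrY.
have [l1 [r1 [ll1 lr1 r1r lrX1]]] := Sbar_open_part SX lr lrX.
have lrY1 : `]l1, r1[ `<=` limit_point Y.
  by move=> x; rewrite /= in_itv/= => x1; apply: lrY; rewrite /= in_itv/=; lra.
have [l2 [r2 [ll2 lr2 r2r lrY2]]] := Sbar_open_part SY lr1 lrY1.
exists `]l2, r2[; first by split; lra.
move=> x xlr; split; last exact: lrY2.
by apply: lrX1; move: xlr; rewrite /= !in_itv/=; lra.
Qed.

Section Pair.
Variables (X Y : set R) (LX LY : seq (R * R)).
Hypotheses (SX : Sbar A B S X) (SY : Sbar A B S Y) (XY : ~ overlap A B X Y).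
Hypotheses (gLX : forall p, p \in LX -> Sbar_itv A B S p)
           (gLY : forall p, p \in LY -> Sbar_itv A B S p).
Hypotheses (sLX : pairwise (@strictly_before R) LX)
           (sLY : pairwise (@strictly_before R) LY).
Hypotheses (EX : limit_point X = covered LX) (EY : limit_point Y = covered LY).

Lemma components_apart p q : p \in LX -> q \in LY -> before p q || before q p.
Proof.
move=> pX qY; apply/norP => -[]; rewrite /before -!ltNge => qp pq; apply: XY.
have ltp := Sbar_itv_lt (gLX pX); have ltq := Sbar_itv_lt (gLY qY).
have [/= [Ap _ pB] _] := gLX pX.
apply: (@overlap_limit_points _ _ (Num.max p.1 q.1) (Num.min p.2 q.2)) => //.
- by rewrite le_max Ap.
- by rewrite gt_max !lt_min ltp ltq pq qp.
- by rewrite ge_min pB.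
- rewrite EX => x; rewrite /= in_itv/= gt_max lt_min => xpq.
  by exists p => //; lra.
- rewrite EY => x; rewrite /= in_itv/= gt_max lt_min => xpq.
  by exists q => //; lra.
Qed.

Lemma merged_components :
  exists L, perm_eq L (LX ++ LY) /\ pairwise (@before R) L.
Proof.
pose le1 p q := (p.1 : R) <= q.1.
exists (sort le1 (LX ++ LY)); split; first exact/permPl/perm_sort.
have tle1 : total le1 by move=> p q; exact: le_total.
have trle1 : transitive le1 by move=> q p r; exact: le_trans.
have gL p : p \in LX ++ LY -> p.1 < p.2.
  by rewrite mem_cat => /orP[/gLX|/gLY]; exact: Sbar_itv_lt.
have apart p q : p \in LX ++ LY -> q \in LX ++ LY -> p != q ->
    before p q || before q p.
  have one s : pairwise (@strictly_before R) s -> p \in s -> q \in s ->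
      p != q -> before p q || before q p.
    elim: s => // r s IH /= /andP[/allP rs /IH{}IH].
    rewrite !inE => /predU1P[->|ps] /predU1P[->|qs]; rewrite ?eqxx// => pq.
    - by rewrite /before (ltW (rs _ qs)).
    - by rewrite /before (ltW (rs _ ps)) orbT.
    - exact: IH.
  rewrite !mem_cat => /orP[pX|pY] /orP[qX|qY] pq.
  - exact: (one _ sLX).
  - exact: components_apart.
  - by rewrite orbC; exact: components_apart.
  - exact: (one _ sLY).
have uniq1 s : (forall p, p \in s -> Sbar_itv A B S p) ->
    pairwise (@strictly_before R) s -> uniq s.
  move=> gs ss; apply: (proj1 (chain_uniq _ _)).
    by move=> p /gs; exact: Sbar_itv_lt.
  by apply: sub_pairwise ss => p q; exact: ltW.
have uL : uniq (LX ++ LY).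
  rewrite cat_uniq !uniq1// andbT /=; apply/hasPn => p pY; apply/negP => pX.
  have := components_apart pX pY; rewrite orbb /before leNgt.
  by rewrite (Sbar_itv_lt (gLX pX)).
have : pairwise [rel p q | le1 p q && (p != q)] (sort le1 (LX ++ LY)).
  by rewrite pairwise_relI -(sorted_pairwise trle1) sort_sorted//= -uniq_pairwise sort_uniq.
apply: (@sub_in_pairwise _ (mem (LX ++ LY))); last first.
  by apply/allP => p; rewrite mem_sort.
move=> p q pL qL /= /andP[le_pq /(apart _ _ pL qL)/orP[//|]].
by move: (gL _ pL) (gL _ qL) le_pq; rewrite /before /le1; lra.
Qed.

(** The interior of q is disjoint from X because q does not overlap any component
    of X; it accumulates at y from outside X. *)
Lemma touching_frontier p q y : p \in LX -> q \in LY ->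
  p.1 <= y <= p.2 -> q.1 <= y <= q.2 -> frontier A B X y.
Proof.
move=> pX qY py qy; split; first by rewrite EX; exists p.
have ltq := Sbar_itv_lt (gLY qY).
have : `[q.1, q.2]%classic y by rewrite /= in_itv.
have <- : limit_point (`]q.1, q.2[%classic : set R) = `[q.1, q.2]%classic.
  by apply: limit_point_between_itv => //; apply: subset_itv; rewrite bnd_simp.
apply: limit_pointS => x xq; have {xq} : q.1 < x < q.2 by move: xq; rewrite /= in_itv.
move=> xq; have [/= [Aq _ qB] _] := gLY qY.
split; first by rewrite /W /= in_itv/=; lra.
move/(Sbar_subset_limit_point SX); rewrite EX => -[r rX xr].
by have := components_apart rX qY; rewrite /before => /orP[]; lra.
Qed.

End Pair.

(** A common point of X' and Y' lies in a component of each, and these do not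
    overlap, hence touch there.  Conversely two touching intervals of the chain
    cannot both be components of the same set, as those are strictly
    separated. *)
Lemma frontier_shared X Y LX LY L :
  Sbar A B S X -> Sbar A B S Y -> ~ overlap A B X Y ->
  (forall p, p \in LX -> Sbar_itv A B S p) -> (forall p, p \in LY -> Sbar_itv A B S p) ->
  pairwise (@strictly_before R) LX -> pairwise (@strictly_before R) LY ->
  limit_point X = covered LX -> limit_point Y = covered LY ->
  perm_eq L (LX ++ LY) ->
  frontier A B X `&` frontier A B Y = [set` shared L].
Proof.
move=> SX SY XY gLX gLY sLX sLY EX EY LXY.
have YX : ~ overlap A B Y X by move=> [J WJ JYX]; apply: XY; exists J; rewrite // setIC.
have memL p : (p \in L) = (p \in LX) || (p \in LY) by rewrite (perm_mem LXY) mem_cat.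
apply/seteqP; split=> y.
  move=> [[+ _] [+ _]]; rewrite EX EY => -[p pX py] [q qY qy] /=.
  have [pq|qp] := orP (components_apart SX SY XY gLX gLY EX EY pX qY).
    apply/sharedP; exists p, q; rewrite !memL pX qY orbT; split=> //.
      by move: pq; rewrite /before; lra.
    by move: pq; rewrite /before; lra.
  apply/sharedP; exists q, p; rewrite !memL pX qY orbT; split=> //.
    by move: qp; rewrite /before; lra.
  by move: qp; rewrite /before; lra.
move=> /sharedP[p [q [pL qL py qy]]].
have touch (p' q' : R * R) : p' \in LX -> q' \in LY -> p'.1 <= y <= p'.2 -> q'.1 <= y <= q'.2 ->
    (frontier A B X `&` frontier A B Y) y.
  move=> pX qY p'y q'y; split.
    exact: (touching_frontier SX SY XY gLX gLY EX EY pX qY).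
  exact: (touching_frontier SY SX YX gLY gLX EY EX qY pX).
have same LZ : (forall p, p \in LZ -> Sbar_itv A B S p) ->
    pairwise (@strictly_before R) LZ -> p \in LZ -> q \in LZ -> False.
  elim: LZ => // r s IH gZ /= /andP[/allP rs ss].
  have gs t : t \in s -> Sbar_itv A B S t by move=> ts; apply: gZ; rewrite inE ts orbT.
  have := Sbar_itv_lt (gZ r (mem_head _ _)).
  rewrite !inE => rr /predU1P[pr|ps] /predU1P[qr|qs].
  - by move: rr; rewrite -[X in X.2]pr -qr py qy ltxx.
  - by have := rs _ qs; rewrite /strictly_before -pr py qy ltxx.
  - have := rs _ ps; have := Sbar_itv_lt (gs _ ps).
    by rewrite /strictly_before -qr py qy in rr *; lra.
  - exact: IH.
have gL r : r \in L -> r.1 < r.2 by rewrite memL => /orP[/gLX|/gLY]; exact: Sbar_itv_lt.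
have := gL _ pL; have := gL _ qL.
move: pL qL; rewrite !memL => /orP[pX|pY] /orP[qX|qY] ltq ltp.
- by have := same _ gLX sLX pX qX.
- by apply: (touch p q) => //; lra.
- by apply: (touch q p) => //; lra.
- by have := same _ gLY sLY pY qY.
Qed.

End Two_sets.

(** * Divisions *)
Section Divisions.
Variables (R : realType) (A B : R) (S : set (interval R)).
Hypothesis SW : S `<=` is_interval_of_W A B.
Variable g : interval R -> R.
Implicit Types (X Y : set R) (D : {fset interval R}) (J K : interval R).

(** This is what allows X to be replaced by a union of closed intervals. *)
Lemma eq_division X Y D : limit_point X = limit_point Y ->
  division A B S X D -> division A B S Y D.
Proof. by move=> XY [? ? DX]; split; rewrite // DX. Qed.

Lemma eq_over X Y (D : nat -> {fset interval R}) :
  limit_point X = limit_point Y -> Defs.over A B S X D -> Defs.over A B S Y D.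
Proof. by move=> XY DX n; exact: eq_division (DX n). Qed.

Lemma norm_ge0 D : 0 <= norm D.
Proof.
rewrite /norm; elim: (enum_fset D) => [|J s IH]; first by rewrite big_nil.
by rewrite big_cons le_max IH orbT.
Qed.

Lemma length_le_norm D J : J \in D -> length J <= norm D.
Proof. by move=> JD; apply: le_bigmax_seq => //; exact: JD. Qed.

(** Used for subsets, and for a splitting, whose two new intervals are parts of
    the interval cut. *)
Lemma norm_le_dominated D D' :
  (forall J, J \in D -> exists2 K, K \in D' & length J <= length K) ->
  norm D <= norm D'.
Proof.
move=> DD'; rewrite /norm big_seq; elim/big_ind : _ => [|x y xn yn|J /DD'[K KD JK]].
- exact: norm_ge0.
- by rewrite ge_max xn.
- exact: le_trans JK (length_le_norm KD).
Qed.

Lemma norm_fsetU D D' e : norm D < e -> norm D' < e -> norm (D `|` D')%fset < e.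
Proof.
move=> De D'e; rewrite /norm big_seq; elim/big_ind : _ => [|x y xn yn|J].
- exact: le_lt_trans (norm_ge0 _) De.
- by rewrite gt_max xn.
- rewrite inE => /orP[JD|JD]; [move: De|move: D'e]; apply: le_lt_trans;
  exact: length_le_norm.
Qed.

Lemma rsum_fsetU D D' : (forall J, J \in D -> J \in D' -> False) ->
  rsum g (D `|` D')%fset = rsum g D + rsum g D'.
Proof.
move=> DD'; rewrite /rsum -big_cat; apply: perm_big; apply: uniq_perm.
- exact: fset_uniq.
- rewrite cat_uniq !fset_uniq andbT /=; apply/hasPn => J JD'.
  by apply/negP => JD; exact: DD' JD JD'.
- by move=> J; rewrite mem_cat inE.
Qed.

Lemma rsum_fset2 J K : J != K -> rsum g [fset J; K]%fset = g J + g K.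
Proof.
move=> JK; rewrite rsum_fsetU; first by rewrite /rsum !big_seq_fset1.
by move=> L; rewrite !inE => /eqP-> /eqP JK'; rewrite JK' eqxx in JK.
Qed.

Section One_division.
Variables (X : set R) (D : {fset interval R}).
Hypothesis DX : division A B S X D.

Lemma division_W J : J \in D -> is_interval_of_W A B J.
Proof. by case: DX => DS _ _ /DS; exact: SW. Qed.

Lemma division_lt J : J \in D -> left_end J < right_end J.
Proof. by move=> /division_W; exact: interval_ends_lt. Qed.

Lemma division_sub J x : J \in D -> left_end J <= x <= right_end J -> limit_point X x.
Proof.
case: (DX) => _ _ <- JD xJ; exists J => //.
by rewrite (interval_closure (division_W JD)) /= in_itv.
Qed.

Lemma division_cover x : limit_point X x ->
  exists2 J, J \in D & left_end J <= x <= right_end J.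
Proof.
case: (DX) => _ _ <- -[J JD].
by rewrite (interval_closure (division_W JD)) /= in_itv => xJ; exists J.
Qed.

(** The condition on the ends says that the interiors of J and K meet. *)
Lemma division_eq J K : J \in D -> K \in D ->
  left_end J < right_end K -> left_end K < right_end J -> J = K.
Proof.
move=> JD KD JK KJ; case: (DX) => _ nov _; apply: contrapT => /nov; apply => //.
have [ltJ AJ JB JI _] := interval_of_W_ends (division_W JD).
have [ltK AK KB KI _] := interval_of_W_ends (division_W KD).
exists `]Num.max (left_end J) (left_end K), Num.min (right_end J) (right_end K)[.
  by split; rewrite ?le_max ?ge_min ?AJ ?JB// gt_max !lt_min ltJ ltK JK KJ.
move=> x; rewrite /= in_itv/= gt_max lt_min => xJK.
by split; [apply: JI|apply: KI]; rewrite /= in_itv/=; lra.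
Qed.

End One_division.

Section Separated_sets.
Variables (X Y : set R) (b : R).
Hypotheses (Xb : forall x, limit_point X x -> x <= b)
           (bY : forall y, limit_point Y y -> b <= y).

Lemma division_disjoint D D' : division A B S X D -> division A B S Y D' ->
  forall J, J \in D -> J \in D' -> False.
Proof.
move=> DX DY J JD JD'; have ltJ := division_lt DX JD.
have := Xb (division_sub DX JD (x := right_end J) _).
have := bY (division_sub DY JD' (x := left_end J) _).
by rewrite !lexx (ltW ltJ) => /(_ isT) + /(_ isT); lra.
Qed.

Lemma rsum_separated D D' : division A B S X D -> division A B S Y D' ->
  rsum g (D `|` D')%fset = rsum g D + rsum g D'.
Proof. by move=> DX DY; apply: rsum_fsetU; exact: division_disjoint DX DY. Qed.

(** An interval common to X and Y would be reduced to the point b. *)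
Lemma separated_not_overlap : Sbar A B S X -> Sbar A B S Y -> ~ overlap A B X Y.
Proof.
move=> SX SY [J WJ JXY]; have [lr _ _ JI _] := interval_of_W_ends WJ.
have pt x : left_end J < x < right_end J -> b = x.
  move=> xJ; have [|Xx Yx] := JXY x; first by apply: JI; rewrite /= in_itv.
  have := Xb (Sbar_subset_limit_point SX Xx).
  by have := bY (Sbar_subset_limit_point SY Yx); lra.
have := pt ((left_end J + right_end J) / 2).
have := pt ((left_end J + 2 * right_end J) / 3).
lra.
Qed.

End Separated_sets.

(** No interval of D crosses the gap, because its closure is contained in the
    union of X' and Y'; hence the left ends tell which intervals divide X.  This is
    the hypothesis on divisions in axiom (v). *)
Lemma division_gap X Y D b c : b < c ->
  (forall x, limit_point X x -> x <= b) -> (forall y, limit_point Y y -> c <= y) ->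
  division A B S (X `|` Y) D ->
  division A B S X [fset J in D | left_end J <= b]%fset /\
  division A B S Y [fset J in D | b < left_end J]%fset.
Proof.
move=> bc Xb cY DXY; have EXY := limit_pointU X Y.
have inX J x : J \in D -> left_end J <= b -> left_end J <= x <= right_end J ->
    limit_point X x.
  move=> JD Jb xJ.
  have rb : right_end J <= b.
    rewrite leNgt; apply/negP => br.
    have ltJ := division_lt DXY JD.
    (* z is in the closure of J and in the gap *)
    pose z := Num.min ((b + c) / 2) (right_end J).
    have : limit_point (X `|` Y) z.
      by apply: (division_sub DXY JD); rewrite /z ge_min le_min lexx; lra.
    have : b < z < c by rewrite /z lt_min gt_min; lra.
    by rewrite EXY => bzc [/Xb|/cY]; lra.
  have := division_sub DXY JD xJ.
  by rewrite EXY => -[//|/cY]; lra.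
have inY J x : J \in D -> b < left_end J -> left_end J <= x <= right_end J ->
    limit_point Y x.
  move=> JD Jb xJ; have := division_sub DXY JD xJ.
  by rewrite EXY => -[/Xb|//]; lra.
have [DS nov _] := DXY.
split; split.
- by move=> J; rewrite !inE => /andP[/DS].
- by move=> J K; rewrite !inE => /andP[JD _] /andP[KD _]; exact: nov.
- apply/seteqP; split=> x.
    move=> [J]; rewrite /= !inE => /andP[JD Jb].
    by rewrite (interval_closure (SW (DS _ JD))) /= in_itv/=; exact: inX.
  move=> Xx; have [|J JD xJ] := division_cover DXY (x := x).
    by rewrite EXY; left.
  exists J; last by rewrite (interval_closure (SW (DS _ JD))) /= in_itv.
  by rewrite /= !inE JD /=; have := Xb _ Xx; lra.
- by move=> J; rewrite !inE => /andP[/DS].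
- by move=> J K; rewrite !inE => /andP[JD _] /andP[KD _]; exact: nov.
- apply/seteqP; split=> x.
    move=> [J]; rewrite /= !inE => /andP[JD Jb].
    by rewrite (interval_closure (SW (DS _ JD))) /= in_itv/=; exact: inY.
  move=> Yx; have [|J JD xJ] := division_cover DXY (x := x).
    by rewrite EXY; right.
  exists J; last by rewrite (interval_closure (SW (DS _ JD))) /= in_itv.
  rewrite /= !inE JD /= ltNge; apply/negP => Jb.
  by have := Xb _ (inX J x JD Jb xJ); have := cY _ Yx; lra.
Qed.

End Divisions.

(** * Splitting a division at a point *)
Section Splittings.
Variables (R : realType) (A B : R) (S : set (interval R)).
Hypothesis SW : S `<=` is_interval_of_W A B.
Variable g : interval R -> R.
Implicit Types (D : {fset interval R}) (J K : interval R).

Lemma closed_itv_limit_point (a d : R) : a < d ->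
  limit_point `[a, d]%classic = `[a, d]%classic.
Proof.
by move=> ad; apply: limit_point_between_itv => //; apply: subset_itv; rewrite bnd_simp.
Qed.

Lemma Sbar_itv_condition_a a x d : Sbar_itv A B S (a, x) -> Sbar_itv A B S (x, d) ->
  condition_a A B S x `[a, d]%classic `[a, x]%classic `[x, d]%classic.
Proof.
move=> [/= Wax Sax] [/= Wxd Sxd]; have [Aa ax _] := Wax; have [_ xd dB] := Wxd.
have E : `[a, d]%classic = `[a, x]%classic `|` `[x, d]%classic.
  apply/seteqP; split=> y /=; rewrite !in_itv/=; last by case; lra.
  by case: (leP y x) => ? ?; [left|right]; lra.
split=> //.
- split; first by rewrite E; exact: SbarU.
  by exists `[a, d] => //; split=> //; lra.
- by rewrite interior_itv/= in_itv/= ax xd.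
- rewrite E; apply/seteqP; split=> y; first by left.
  by case=> // ->; left; rewrite /= in_itv/=; lra.
- by exists `[a, x], `[x, d]; split=> //; split; [right|left].
Qed.

Section One_splitting.
Variables (a x d : R) (D D1 D2 : {fset interval R}).
Hypotheses (ax : a < x) (xd : x < d).
Hypothesis DI : division A B S `[a, d]%classic D.
Hypothesis sp : splitting A B S x `[a, x]%classic `[x, d]%classic D D1 D2.

Let D1I : division A B S `[a, x]%classic D1. Proof. by case: sp. Qed.
Let D2I : division A B S `[x, d]%classic D2. Proof. by case: sp. Qed.

(** A point of the divided interval that is not an end of an interval of D lies
    inside one of them. *)
Lemma splitting_cases :
  (division_point D x /\ (D1 `|` D2)%fset = D) \/
  (~ division_point D x /\ exists J J1 J2, cuts x D D1 D2 J J1 J2).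
Proof.
have [_ _ sp1 sp2] := sp; have [Dx|nDx] := pselect (division_point D x).
  by left; split=> //; exact: sp1.
right; split=> //; have ad : a < d by exact: lt_trans xd.
have axd : a <= x <= d by rewrite !ltW.
have [|J JD xJ] := division_cover SW DI (x := x).
  by rewrite closed_itv_limit_point//= in_itv.
exists J; apply: sp2 => //.
rewrite (interval_interior (division_W SW DI JD)) /= in_itv/=.
have xl : x != left_end J by apply/eqP => xl; apply: nDx; exists J => //; left.
have xr : x != right_end J by apply/eqP => xr; apply: nDx; exists J => //; right.
by rewrite !lt_neqAle eq_sym xl xr.
Qed.

Lemma cuts_sub J J1 J2 : cuts x D D1 D2 J J1 J2 ->
  (forall K, K = J1 \/ K = J2 -> left_end J <= left_end K /\ right_end K <= right_end J).
Proof.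
move=> [[JD _] J1D J2D _ E] K KJ.
have WJ := division_W SW DI JD.
have WK : is_interval_of_W A B K.
  by case: KJ => ->; [exact: (division_W SW D1I J1D)|exact: (division_W SW D2I J2D)].
have EK : `[left_end K, right_end K]%classic `<=` `[left_end J, right_end J]%classic.
  rewrite -(interval_limit_point WJ) -E -(interval_limit_point WK).
  by case: KJ => -> y; [left|right].
have ltK := interval_ends_lt WK.
have := EK (left_end K); have := EK (right_end K).
by rewrite /= !in_itv/= !lexx (ltW ltK) => /(_ isT)/andP[] ? ? /(_ isT)/andP[].
Qed.

(** A splitting never increases the norm; hence the restriction norm < e
    survives all the cuts along a chain. *)
Lemma splitting_norm : norm D1 <= norm D /\ norm D2 <= norm D.
Proof.
suff dom K : K \in (D1 `|` D2)%fset -> exists2 K', K' \in D & length K <= length K'.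
  by split; apply: norm_le_dominated => K KD; apply: dom; rewrite inE KD ?orbT.
have [[_ ->]|[_ [J [J1 [J2 c]]]]] := splitting_cases; first by exists K.
have sub := cuts_sub c; case: c => -[JD _] _ _ -> _.
rewrite !inE => /orP[/andP[_ KD]|KJ]; first by exists K.
exists J => //; rewrite /length.
have : K = J1 \/ K = J2 by case/orP: KJ => /eqP; [left|right].
by move=> /sub; lra.
Qed.

Let left_le y : limit_point `[a, x]%classic y -> y <= x.
Proof. by rewrite closed_itv_limit_point//= in_itv/= => /andP[]. Qed.

Let right_ge y : limit_point `[x, d]%classic y -> x <= y.
Proof. by rewrite closed_itv_limit_point//= in_itv/= => /andP[]. Qed.

Let rsum12 : rsum g (D1 `|` D2)%fset = rsum g D1 + rsum g D2.
Proof. exact: (rsum_separated SW g left_le right_ge D1I D2I). Qed.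

Lemma splitting_rsum_point : division_point D x -> rsum g D = rsum g D1 + rsum g D2.
Proof. by case: sp => _ _ + _ Dx => /(_ Dx) <-. Qed.

(** J1 and J2 are not already in D minus J, as they would overlap J, and they
    are distinct, as they lie on different sides of x; therefore the sums over
    D1 + D2 and over D differ only in these intervals. *)
Lemma splitting_rsum_cut J J1 J2 : cuts x D D1 D2 J J1 J2 ->
  rsum g D - rsum g D1 - rsum g D2 = g J - g J1 - g J2.
Proof.
move=> c; have sub := cuts_sub c; case: c => -[JD Jx] J1D J2D E _.
have W1 := division_W SW D1I J1D; have W2 := division_W SW D2I J2D.
have lt1 := interval_ends_lt W1; have lt2 := interval_ends_lt W2.
have J12 : J1 != J2.
  apply/eqP => J12; apply: (division_disjoint SW left_le right_ge D1I D2I J1D).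
  by rewrite J12.
have new K : K \in (D `\ J)%fset -> K \in [fset J1; J2]%fset -> False.
  rewrite !inE => /andP[/eqP KJ KD] /orP KJ12; apply: KJ.
  have KJ12' : K = J1 \/ K = J2 by case: KJ12 => /eqP; [left|right].
  have := sub _ KJ12'; have := division_lt SW DI KD; have := division_lt SW DI JD.
  by move=> ? ? []; move=> ? ?; apply: (division_eq SW DI KD JD); lra.
have : rsum g D1 + rsum g D2 = rsum g D - g J + (g J1 + g J2).
  rewrite -rsum12 E (rsum_fsetU _ new) rsum_fset2//; congr (_ + _).
  by rewrite /rsum [in RHS](big_fsetD1 J)//= addrC addrK.
by lra.
Qed.

End One_splitting.
End Splittings.

(** * Breaking up a succession along a chain of intervals *)
Section Family.
Variables (R : realType) (A B : R) (S : set (interval R)).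
Hypothesis SW : S `<=` is_interval_of_W A B.
Variable F : set (nat -> {fset interval R}).
Hypothesis hF : burkill_family A B S F.
Variable g : interval R -> R.
Implicit Types (X Y : set R) (p q : R * R) (L : seq (R * R)).
Implicit Types (D : nat -> {fset interval R}).

Lemma family_norm D : F D -> norm (D n) @[n --> \oo] --> 0.
Proof. by move=> /(family_succession hF)[X _ []]. Qed.

Lemma family_norm_lt D e : F D -> 0 < e -> \forall n \near \oo, norm (D n) < e.
Proof. by move=> /family_norm + e0 => /cvgr_lt; exact. Qed.

(** As the family tells only that some set is divided by its successions, the
    divided set is identified by its derived set. *)
Lemma family_over X D : F D ->
  (forall n, \bigcup_(J in [set` D n]) closure [set` J] = limit_point X) ->
  Defs.over A B S X D.
Proof.
move=> /(family_succession hF)[Y _ [DY _]] DX.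
by apply: (eq_over _ DY); rewrite -(DX 0%N); case: (DY 0%N).
Qed.

Lemma family_over_one X D n : F D -> division A B S X (D n) -> Defs.over A B S X D.
Proof.
move=> /(family_succession hF)[Y _ [DY _]] [_ _ DX].
by apply: (eq_over _ DY); rewrite -DX; case: (DY n).
Qed.

(** Axiom (iii); that the unions are divisions follows from their membership in
    the family. *)
Lemma family_union X Y D D' : Sbar A B S X -> Sbar A B S Y -> ~ overlap A B X Y ->
  F D -> F D' -> Defs.over A B S X D -> Defs.over A B S Y D' ->
  F (fun n => D n `|` D' n)%fset /\
  Defs.over A B S (X `|` Y) (fun n => D n `|` D' n)%fset.
Proof.
move=> SX SY XY FD FD' DX D'Y.
have FU := axiom_iii hF SX SY XY FD FD' DX D'Y.
split=> //; apply: family_over => // n.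
have [_ _ EX] := DX n; have [_ _ EY] := D'Y n.
rewrite limit_pointU -EX -EY -bigcup_setU.
suff -> : [set` (D n `|` D' n)%fset] = [set` D n] `|` [set` D' n] by [].
by apply/seteqP; split => J /=; rewrite inE => /orP.
Qed.

(** Axiom (v) for two sets separated by a gap. *)
Lemma family_gap X Y D b c : b < c ->
  (forall x, limit_point X x -> x <= b) -> (forall y, limit_point Y y -> c <= y) ->
  Sbar A B S X -> Sbar A B S Y -> F D -> Defs.over A B S (X `|` Y) D ->
  exists D1 D2, [/\ F D1, F D2, Defs.over A B S X D1, Defs.over A B S Y D2 &
    forall n, D n = (D1 n `|` D2 n)%fset].
Proof.
move=> bc Xb cY SX SY FD DXY.
pose left (E : {fset interval R}) := [fset J in E | left_end J <= b]%fset.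
pose right (E : {fset interval R}) := [fset J in E | b < left_end J]%fset.
have leftright E : E = (left E `|` right E)%fset.
  by apply/fsetP => J; rewrite !inE -andb_orr ltNge orbN andbT.
pose Xs (i : 'I_2) := if i == ord0 then X else Y.
pose Ds (i : 'I_2) E := if i == ord0 then left E else right E.
have DsE E : (\bigcup_(i <- enum 'I_2) Ds i E)%fset = E.
  by rewrite big_enum/= big_ord_recl big_ord1 /Ds/= -leftright.
have DsX E i : division A B S (X `|` Y) E -> division A B S (Xs i) (Ds i E).
  by move=> /(division_gap SW bc Xb cY)[? ?]; rewrite /Xs /Ds; case: ifP.
have bY y : limit_point Y y -> b <= y by move=> /cY; lra.
have XY := separated_not_overlap Xb bY SX SY.
have YX : ~ overlap A B Y X.
  by move=> [J WJ JYX]; apply: XY; exists J; rewrite // setIC.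
have FDs : forall i, F (fun n => Ds i (D n)).
  apply: (@axiom_v _ _ _ _ _ hF (X `|` Y) 2%N Xs _ _ _ _ _ D) => //.
  - exact: SbarU.
  - by move=> i; rewrite /Xs; case: ifP.
  - move=> i j; rewrite /Xs; case: ifPn; case: ifPn => //.
      by move=> /eqP-> /eqP->.
    by case: i => -[|[|//]]/= ?; case: j => -[|[|//]]/= ? //= _ _ []; exact: val_inj.
  - apply/seteqP; split=> [x [Xx|Yx]|x [i _]].
    + by exists ord0.
    + by exists ord_max.
    + by rewrite /Xs; case: ifP; [left|right].
  - move=> E EXY; exists (fun i => Ds i E); split; last by rewrite DsE.
    by move=> i; exact: DsX.
  - by move=> i n; exact: DsX.
exists (fun n => left (D n)), (fun n => right (D n)); split.
- exact: (FDs ord0).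
- exact: (FDs ord_max).
- by move=> n; exact: (DsX _ ord0).
- by move=> n; exact: (DsX _ ord_max).
- by move=> n; exact: leftright.
Qed.

(** Condition (a) at a point of contact needs an interval around it, and the
    succession must be one over that interval.  So the maximal run of touching
    intervals at the head of the chain is split from the remaining part M, which
    lies beyond a gap from d to c. *)
Lemma component_of_head p L : (forall q, q \in p :: L -> Sbar_itv A B S q) ->
  pairwise (@before R) (p :: L) ->
  exists d c M, [/\ Sbar_itv A B S (p.1, d), p.2 <= d,
    covered (p :: L) = `[p.1, d]%classic `|` covered M,
    forall q, q \in M -> Sbar_itv A B S q &
    d < c /\ forall q, q \in M -> c <= q.1].
Proof.
elim: L p => [|q L IH] p gL bL; have gp := gL p (mem_head _ _);
  have gp' : Sbar_itv A B S (p.1, p.2) by case: (p) gp.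
  exists p.2, (p.2 + 1), [::]; split=> //; first exact: covered_cons.
  by split=> //; lra.
have gt r : r \in q :: L -> Sbar_itv A B S r by move=> rL; apply: gL; rewrite inE rL orbT.
have [ltL bL'] := chain_tail (fun q qL => Sbar_itv_lt (gL q qL)) bL.
have pq : p.2 <= q.1 by apply: (chain_after bL); rewrite mem_head.
have [{}pq|qp] := ltP p.2 q.1.
  exists p.2, q.1, (q :: L); split=> //; first exact: covered_cons.
  split=> // r; rewrite inE => /predU1P[->//|rL].
  by have := chain_after bL' rL; have := ltL q (mem_head _ _); lra.
have {}pq : p.2 = q.1 by apply/eqP; rewrite eq_le pq.
have [d [c [M [gd qd E gM [dc cM]]]]] := IH q gt bL'.
have ltp := Sbar_itv_lt gp; have ltq := ltL q (mem_head _ _).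
have qp' : (q.1, d).1 <= p.2 by rewrite pq.
have pd : p.1 <= (q.1, d).2 by rewrite /=; lra.
have [gm Em] := Sbar_itv_merge gp gd qp' pd; rewrite /= in gm Em.
have m1 : Num.min p.1 q.1 = p.1 by apply/min_idPl; lra.
have m2 : Num.max p.2 d = d by apply/max_idPr; lra.
rewrite m1 m2 in gm Em; exists d, c, M; split=> //; first lra.
by rewrite covered_cons E Em setUA.
Qed.

(** T is the class of admissible reindexings: all sequences tending to infinity
    for the Burkill integrals, the identity alone for the norm-limits. *)
Section Chain_splitting.
Variable T : (nat -> nat) -> Prop.
Hypotheses (T_id : T id) (T_comp : forall s s', T s -> T s' -> T (s \o s'))
  (T_cvg : forall s, T s -> s n @[n --> \oo] --> \oo).

Lemma family_reindex X D s : T s -> F D -> Defs.over A B S X D ->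
  F (D \o s) /\ Defs.over A B S X (D \o s).
Proof.
by move=> Ts FD DX; split; [exact: (axiom_ii hF FD (T_cvg Ts))|move=> n; exact: DX].
Qed.

(** Along an admissible reindexing, every succession over [a, d] can be cut at x
    with an error of at most w in each division of norm less than e. *)
Definition cut_bound (w e a x d : R) : Prop :=
  forall D, F D -> Defs.over A B S `[a, d]%classic D ->
  exists s D1 D2, [/\ T s,
    F D1 /\ Defs.over A B S `[a, x]%classic D1,
    F D2 /\ Defs.over A B S `[x, d]%classic D2 &
    forall n, norm (D (s n)) < e ->
      [/\ norm (D1 n) < e, norm (D2 n) < e &
        rsum g (D (s n)) <= rsum g (D1 n) + rsum g (D2 n) + w]].

Definition cuts_near (w : R -> R) (x : R) : Prop :=
  forall a d, Sbar_itv A B S (a, x) -> Sbar_itv A B S (x, d) ->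
    \forall e \near 0^'+, cut_bound (w x) e a x d.

Lemma norm_sub (E E' : {fset interval R}) : {subset E <= E'} -> norm E <= norm E'.
Proof. by move=> EE'; apply: norm_le_dominated => J /EE' JE'; exists J. Qed.

Lemma itv_le a b y : Sbar_itv A B S (a, b) -> limit_point `[a, b]%classic y -> y <= b.
Proof.
by move=> /Sbar_itv_lt ab; rewrite closed_itv_limit_point//= in_itv/= => /andP[].
Qed.

Lemma covered_ge c M y : (forall q, q \in M -> Sbar_itv A B S q) ->
  (forall q, q \in M -> c <= q.1) -> limit_point (covered M) y -> c <= y.
Proof.
move=> gM cM; rewrite covered_limit_point => [[q qM /andP[qy _]]|q /gM]; last exact: Sbar_itv_lt.
exact: le_trans (cM _ qM) qy.
Qed.

(** If p and q do not touch, p lies beyond a gap.  Otherwise the run [p.1, d] at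
    the head is isolated, cut at p.2, and its right half [p.2, d] is united with
    the part M of the chain beyond the run. *)
Lemma split_head w p q L : (forall r, r \in [:: p, q & L] -> Sbar_itv A B S r) ->
  pairwise (@before R) [:: p, q & L] ->
  (p.2 = q.1 -> cuts_near w p.2) ->
  \forall e \near 0^'+, forall D, F D -> Defs.over A B S (covered [:: p, q & L]) D ->
  exists s D1 D2, [/\ T s,
    F D1 /\ Defs.over A B S `[p.1, p.2]%classic D1,
    F D2 /\ Defs.over A B S (covered (q :: L)) D2 &
    forall n, norm (D (s n)) < e ->
      [/\ norm (D1 n) < e, norm (D2 n) < e &
        rsum g (D (s n)) <= rsum g (D1 n) + rsum g (D2 n)
          + (if p.2 == q.1 then w p.2 else 0)]].
Proof.
move=> gpL bpL cutp.
have gp : Sbar_itv A B S (p.1, p.2) by case: (p) (gpL p (mem_head _ _)).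
have gL r : r \in q :: L -> Sbar_itv A B S r by move=> rL; apply: gpL; rewrite inE rL orbT.
have [ltL bL] := chain_tail (fun r rL => Sbar_itv_lt (gpL r rL)) bpL.
have SqL := Sbar_covered gL isT.
have pq : p.2 <= q.1 by apply: (chain_after bpL); rewrite mem_head.
have [pq'|pq'] := eqVneq p.2 q.1; last first.
  have {pq pq'}pq : p.2 < q.1 by rewrite lt_neqAle pq'.
  have qL r : r \in q :: L -> q.1 <= r.1.
    rewrite inE => /predU1P[->//|rL].
    by have := chain_after bL rL; have := ltL q (mem_head _ _); lra.
  near=> e => D FD; rewrite covered_cons => DX.
  have [D1 [D2 [FD1 FD2 D1X D2X E]]] :=
    family_gap pq (fun y => itv_le gp) (fun y => covered_ge gL qL) gp.2 SqL FD DX.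
  exists id, D1, D2; split=> // n ne; split.
  - by apply: le_lt_trans ne; apply: norm_sub => J JD; rewrite E inE JD.
  - by apply: le_lt_trans ne; apply: norm_sub => J JD; rewrite E inE JD orbT.
  - rewrite addr0 E (rsum_separated SW g (b := p.2) _ _ (D1X n) (D2X n))// => y.
      exact: itv_le.
    by move=> /(covered_ge gL qL); lra.
have [d [c [M [gd qd EqL gM [dc cM]]]]] := component_of_head gL bL.
rewrite -pq' in gd EqL.
have ltp := Sbar_itv_lt gp; have ltd := Sbar_itv_lt gd; rewrite /= in ltp ltd.
have EI : `[p.1, d]%classic = `[p.1, p.2]%classic `|` `[p.2, d]%classic.
  apply/seteqP; split=> y /=; rewrite !in_itv/=; last by case; lra.
  by case: (leP y p.2) => ? ?; [left|right]; lra.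
have EpL : covered [:: p, q & L] = `[p.1, d]%classic `|` covered M.
  by rewrite covered_cons EqL EI setUA.
have gI : Sbar_itv A B S (p.1, d).
  have [pd] := (lexx p.2, ltW (lt_trans ltp ltd)).
  have [] := Sbar_itv_merge gp gd; rewrite //=; last first.
    by move=> + _; rewrite min_l ?max_r// ltW.
  by rewrite ltW// (lt_trans ltp).
have cM' y := @covered_ge c M y gM cM.
near=> e => D FD; rewrite EpL => DX.
have cut : cut_bound (w p.2) e p.1 p.2 d.
  by near: e; exact: (cutp pq' _ _ gp gd).
have [M0|M0] := eqVneq M [::].
  rewrite M0 covered_nil !setU0 in EqL DX.
  rewrite EqL; have [s [D1 [D2 [Ts FD1 FD2 sD]]]] := cut _ FD DX.
  by exists s, D1, D2.
have SM := Sbar_covered gM M0.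
have [DI [DM [FDI FDM DII DMM E]]] :=
  family_gap dc (fun y => itv_le gI) cM' gI.2 SM FD DX.
have [s [D1 [D2 [Ts [FD1 D1I] [FD2 D2I] sD]]]] := cut _ FDI DII.
have [FDMs DMMs] := family_reindex Ts FDM DMM.
have dM y : limit_point (covered M) y -> d <= y by move=> /cM'; lra.
have nov := separated_not_overlap (fun y => itv_le gd) dM gd.2 SM.
have [FU UX] := family_union gd.2 SM nov FD2 FDMs D2I DMMs.
exists s, D1, (fun n => D2 n `|` DM (s n))%fset; split=> //.
  by split=> //; rewrite EqL.
move=> n ne.
have nI : norm (DI (s n)) < e.
  by apply: le_lt_trans ne; apply: norm_sub => J JD; rewrite E inE JD.
have nM : norm (DM (s n)) < e.
  by apply: le_lt_trans ne; apply: norm_sub => J JD; rewrite E inE JD orbT.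
have [n1 n2 gle] := sD n nI; split=> //; first exact: norm_fsetU.
rewrite E (rsum_separated SW g (fun y => itv_le gI) dM (DII _) (DMM _)).
rewrite (rsum_separated SW g (fun y => itv_le gd) dM (D2I _) (DMM _)).
by move: gle; lra.
Unshelve. all: by end_near. Qed.

(** Each step keeps the left half and continues with the right one.  The pieces
    already cut off are reindexed along with the later choices. *)
Lemma chain_splitting w L : (forall r, r \in L -> Sbar_itv A B S r) ->
  pairwise (@before R) L -> L != [::] ->
  (forall x, x \in shared L -> cuts_near w x) ->
  \forall e \near 0^'+, forall D, F D -> Defs.over A B S (covered L) D ->
  exists s (Ds : R * R -> nat -> {fset interval R}), [/\ T s,
    forall p, p \in L -> F (Ds p) /\ Defs.over A B S `[p.1, p.2]%classic (Ds p) &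
    forall n, norm (D (s n)) < e ->
      (forall p, p \in L -> norm (Ds p n) < e) /\
      rsum g (D (s n)) <= \sum_(p <- L) rsum g (Ds p n) + \sum_(y <- shared L) w y].
Proof.
elim: L => // p [|q L] IH gL bL _ cutL.
  near=> e => D FD; rewrite covered1 => DX; exists id, (fun=> D); split=> //.
    by move=> r; rewrite inE => /eqP ->.
  move=> n ne; split; first by [].
  rewrite big_seq1 (shared_cons (fun r rL => Sbar_itv_lt (gL r rL)) bL).
  by rewrite big_nil addr0.
have ltL r : r \in [:: p, q & L] -> r.1 < r.2 by move=> /gL; exact: Sbar_itv_lt.
have Esh := shared_cons ltL bL; have pL := chain_head_notin ltL bL.
have [ltL' bL'] := chain_tail ltL bL.
have gL' r : r \in q :: L -> Sbar_itv A B S r by move=> rL; apply: gL; rewrite inE rL orbT.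
have pq : (p.2 \in [seq r.1 | r <- q :: L]) = (p.2 == q.1).
  apply/mapP/eqP => [[r]|->]; last by exists q; rewrite ?mem_head.
  rewrite inE => /predU1P[->//|rL pr].
  have := chain_after bL' rL; have := ltL' q (mem_head _ _).
  have : p.2 <= q.1 by apply: (chain_after bL); rewrite mem_head.
  by move: pr; lra.
rewrite pq in Esh.
have cutp : p.2 = q.1 -> cuts_near w p.2.
  by move=> /eqP E; apply: cutL; rewrite Esh E mem_head.
have cutL' x : x \in shared (q :: L) -> cuts_near w x.
  by move=> xL; apply: cutL; rewrite Esh; case: ifP => // _; rewrite inE xL orbT.
near=> e => D FD DX.
have [s [D1 [D2 [Ts [FD1 D1X] [FD2 D2X] sD]]]] : exists s D1 D2, [/\ T s,
    F D1 /\ Defs.over A B S `[p.1, p.2]%classic D1,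
    F D2 /\ Defs.over A B S (covered (q :: L)) D2 &
    forall n, norm (D (s n)) < e ->
      [/\ norm (D1 n) < e, norm (D2 n) < e &
        rsum g (D (s n)) <= rsum g (D1 n) + rsum g (D2 n)
          + (if p.2 == q.1 then w p.2 else 0)]].
  by move: D FD DX; near: e; exact: split_head.
have [s' [Ds [Ts' FDs sD2]]] : exists s' (Ds : R * R -> nat -> {fset interval R}),
    [/\ T s',
    forall r, r \in q :: L ->
      F (Ds r) /\ Defs.over A B S `[r.1, r.2]%classic (Ds r) &
    forall n, norm (D2 (s' n)) < e ->
      (forall r, r \in q :: L -> norm (Ds r n) < e) /\
      rsum g (D2 (s' n)) <= \sum_(r <- q :: L) rsum g (Ds r n)
        + \sum_(y <- shared (q :: L)) w y].
  by move: D2 FD2 D2X {sD}; near: e; exact: IH.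
pose Ds' r := if r == p then D1 \o s' else Ds r.
have Dsp : Ds' p = D1 \o s' by rewrite /Ds' eqxx.
have DsL r : r \in q :: L -> Ds' r = Ds r.
  by rewrite /Ds'; case: eqP => // -> pL'; rewrite pL' in pL.
exists (s \o s'), Ds'; split; first exact: T_comp.
  move=> r; rewrite inE => /predU1P[->|rL]; last by rewrite DsL//; exact: FDs.
  by rewrite Dsp; exact: family_reindex.
move=> n ne; have [n1 n2 gle] := sD (s' n) ne; have [nDs gle'] := sD2 n n2.
split.
  move=> r; rewrite inE => /predU1P[->|rL]; first by rewrite Dsp.
  by rewrite DsL//; exact: nDs.
rewrite big_cons Dsp /=.
have -> : \sum_(r <- q :: L) rsum g (Ds' r n) = \sum_(r <- q :: L) rsum g (Ds r n).
  by apply: eq_big_seq => r rL; rewrite DsL.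
have -> : \sum_(y <- shared [:: p, q & L]) w y =
    (if p.2 == q.1 then w p.2 else 0) + \sum_(y <- shared (q :: L)) w y.
  by rewrite Esh; case: ifP; rewrite ?big_cons ?add0r.
by move: gle gle'; rewrite /=; lra.
Unshelve. all: by end_near. Qed.

(** The converse operation, without error: pieces with disjoint interiors add
    up. *)
Lemma family_gather L (Ds : R * R -> nat -> {fset interval R}) :
  (forall p, p \in L -> Sbar_itv A B S p) -> pairwise (@before R) L -> L != [::] ->
  (forall p, p \in L -> F (Ds p) /\ Defs.over A B S `[p.1, p.2]%classic (Ds p)) ->
  exists D, [/\ F D, Defs.over A B S (covered L) D,
    forall n, rsum g (D n) = \sum_(p <- L) rsum g (Ds p n) &
    forall n e, (forall p, p \in L -> norm (Ds p n) < e) -> norm (D n) < e].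
Proof.
elim: L => // p [|q L] IH gL bL _ FDs.
  have [FD DX] := FDs p (mem_head _ _).
  exists (Ds p); rewrite covered1; split=> // n; first by rewrite big_seq1.
  by move=> e; apply; exact: mem_head.
have [ltL bL'] := chain_tail (fun r rL => Sbar_itv_lt (gL r rL)) bL.
have gL' r : r \in q :: L -> Sbar_itv A B S r by move=> rL; apply: gL; rewrite inE rL orbT.
have FDs' r : r \in q :: L -> F (Ds r) /\ Defs.over A B S `[r.1, r.2]%classic (Ds r).
  by move=> rL; apply: FDs; rewrite inE rL orbT.
have [D [FD DX Dsum Dn]] := IH gL' bL' isT FDs'.
have [FDp DpX] := FDs p (mem_head _ _).
have gp : Sbar_itv A B S (p.1, p.2) by case: (p) (gL p (mem_head _ _)).
have pL r : r \in q :: L -> p.2 <= r.1 by exact: chain_after.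
have SL := Sbar_covered gL' isT.
have nov := separated_not_overlap (fun y => itv_le gp) (fun y => covered_ge gL' pL) gp.2 SL.
have [FU UX] := family_union gp.2 SL nov FDp FD DpX DX.
exists (fun n => Ds p n `|` D n)%fset; split=> //.
- by rewrite covered_cons.
- move=> n; rewrite big_cons -Dsum.
  exact: (rsum_separated SW g (fun y => itv_le gp) (fun y => covered_ge gL' pL) (DpX n) (DX n)).
- move=> n e ne; apply: norm_fsetU; first by apply: ne; exact: mem_head.
  by apply: Dn => r rL; apply: ne; rewrite inE rL orbT.
Qed.

End Chain_splitting.
End Family.

(** * Upper limits and limits from the right *)
Section Limits.
Variable R : realType.
Local Open Scope ereal_scope.
Implicit Types (u : nat -> \bar R) (f : R -> \bar R) (w : \bar R).

Lemma limn_esup_lt u w : limn_esup u < w -> \forall n \near \oo, u n < w.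
Proof.
move=> /ereal_inf_lt[_ [V Voo <-] Vw]; apply: filterS Voo => n Vn.
by apply: le_lt_trans Vw; apply: ereal_sup_ubound; exists n.
Qed.

Lemma lt_limn_esup u w : w < limn_esup u -> forall N, exists2 n, (N <= n)%N & w < u n.
Proof.
move=> wu N; have : w < ereal_sup [set u n | n in [set n | (N <= n)%N]].
  apply: lt_le_trans wu _; apply: ereal_inf_lbound.
  by exists [set n | (N <= n)%N] => //; exists N.
by move=> /ereal_sup_gt[_ [n Nn <-] wn]; exists n.
Qed.

Lemma subsequence (P : nat -> Prop) : (forall N, exists2 n, (N <= n)%N & P n) ->
  exists s : nat -> nat, s n @[n --> \oo] --> \oo /\ forall n, P (s n).
Proof.
move=> PN; have /choice[s sP] : forall N, exists n, (N <= n)%N /\ P n.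
  by move=> N; have [n] := PN N; exists n.
exists s; split=> [|n]; last by have [] := sP n.
move=> V [N _ NV]; exists N => // n /= Nn; apply: NV => /=.
by apply: leq_trans Nn _; have [] := sP n.
Qed.

Lemma cvg_shift N : (n + N)%N @[n --> \oo] --> \oo.
Proof.
move=> V [M _ MV]; exists M => // n /= Mn; apply: MV.
exact: leq_trans (leq_addr _ _).
Qed.

Lemma lim_at_right_nondecreasing f :
  (forall e e', (0 < e)%R -> (e <= e')%R -> f e <= f e') ->
  f e @[e --> (0%R : R)^'+] --> ereal_inf [set f e | e in [set e | (0 < e)%R]].
Proof.
move=> ndf.
have -> : [set e : R | (0 < e)%R] = [set` Interval (BRight (0%R : R)) +oo%O].
  by apply/seteqP; split=> e /=; rewrite in_itv/= andbT.
apply: nondecreasing_at_right_cvge => // e e'.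
by rewrite !in_itv/= !andbT => e0 _; exact: ndf.
Qed.

Lemma near_lim_at_right_lt f w :
  (forall e e', (0 < e)%R -> (e <= e')%R -> f e <= f e') ->
  lim (f e @[e --> (0%R : R)^'+]) < w -> \forall e \near (0%R : R)^'+, f e < w.
Proof.
move=> ndf; have -> := cvg_lim _ (lim_at_right_nondecreasing ndf) => //.
move=> /ereal_inf_lt[_ [e /= e0 <-] few].
near=> e'; apply: le_lt_trans few; apply: ndf.
  by near: e'; exact: nbhs_right_gt.
by near: e'; exact: nbhs_right_le.
Unshelve. all: by end_near. Qed.

End Limits.

(** * The error of one cut *)
Definition to_infinity : set (nat -> nat) := [set s | s n @[n --> \oo] --> \oo].

Lemma to_infinity_id : to_infinity id.
Proof. by move=> V. Qed.

Lemma to_infinity_comp s s' : to_infinity s -> to_infinity s' -> to_infinity (s \o s').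
Proof. by move=> soo s'oo V /soo; exact: s'oo. Qed.

Section Cuts.
Variables (R : realType) (A B : R) (S : set (interval R)).
Hypothesis SW : S `<=` is_interval_of_W A B.
Variable F : set (nat -> {fset interval R}).
Hypothesis hF : burkill_family A B S F.
Variable g : interval R -> R.


(** If x is a division-point of infinitely many divisions, the subsequence
    formed by these is cut at no cost.  Otherwise the errors of the splittings
    have an upper limit of at most b(x;F), which is less than w x, and finitely
    many terms are dropped. *)
Lemma cuts_near_family (w : R -> R) (x : R) :
  (b_family A B S g F x < (w x)%:E)%E -> cuts_near A B S F g to_infinity w x.
Proof.
move=> bw a d gax gxd; near=> e => D FD DI.
have C := Sbar_itv_condition_a gax gxd.
have ax := Sbar_itv_lt gax; have xd := Sbar_itv_lt gxd; rewrite /= in ax xd.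
have {bw}bw : (b_on A B S g F x `[a, d]%classic < (w x)%:E)%E.
  apply: le_lt_trans bw; apply: ereal_sup_ubound; exists `[a, d]%classic => //.
  by exists `[a, x]%classic, `[x, d]%classic.
have w0 : 0 < w x.
  by rewrite -lte_fin; apply: le_lt_trans bw; rewrite /b_on le_max lexx.
have [inf|fin] := pselect (forall N, exists2 n, (N <= n)%N & division_point (D n) x).
  have [s [soo sD]] := subsequence inf.
  have FDs := axiom_ii hF FD soo.
  have DsI : Defs.over A B S `[a, d]%classic (fun n => D (s n)) by move=> n; exact: DI.
  have [D1 [D2 [FD1 FD2 sp]]] := axiom_vi hF C FDs DsI.
  exists s, D1, D2; split=> //; [by split=> // n; case: (sp n)..|].
  move=> n ne; have [n1 n2] := splitting_norm SW ax xd (DsI n) (sp n); split.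
  - exact: le_lt_trans ne.
  - exact: le_lt_trans ne.
  - by rewrite (splitting_rsum_point SW g ax xd (sp n) (sD n)) lerDl ltW.
have {fin}[N ND] : exists N, forall n, (N <= n)%N -> ~ division_point (D n) x.
  move/existsNP: fin => [N ND]; exists N => n Nn Dn; apply: ND; by exists n.
have [D1 [D2 [FD1 FD2 sp]]] := axiom_vi hF C FD DI.
have /choice[JJJ JJJc] : forall n, exists JJJ : interval R * interval R * interval R,
    (N <= n)%N -> cuts x (D n) (D1 n) (D2 n) JJJ.1.1 JJJ.1.2 JJJ.2.
  move=> n; have [[Dn _]|[_ [J [J1 [J2 c]]]]] := splitting_cases SW ax xd (DI n) (sp n).
    (* an arbitrary triple for the finitely many n below N *)
    by exists (`[a, a], `[a, a], `[a, a]) => /ND.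
  by exists (J, J1, J2).
pose err n := split_error g (JJJ n).1.1 (JJJ n).1.2 (JJJ n).2.
have /limn_esup_lt[M _ Mw] : (limn_esup (fun n => (err n)%:E) < (w x)%:E)%E.
  apply: le_lt_trans bw; rewrite /b_on le_max; apply/orP; right.
  apply: (@le_trans _ _ (split_limsup A B S g F x `[a, x]%classic `[x, d]%classic D)).
    apply: ereal_sup_ubound; exists D1, D2.
    exists (fun n => (JJJ n).1.1), (fun n => (JJJ n).1.2), (fun n => (JJJ n).2).
    by split=> //; exists N.
  apply: ereal_sup_ubound; exists D, `[a, x]%classic, `[x, d]%classic.
  by split=> //; exists N.
exists (fun n => n + (N + M))%N, (fun n => D1 (n + (N + M))%N), (fun n => D2 (n + (N + M))%N).
split=> /=.
- exact: cvg_shift.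
- by split; [exact: (axiom_ii hF FD1 (cvg_shift (N + M)))|move=> n; case: (sp (n + (N + M))%N)].
- by split; [exact: (axiom_ii hF FD2 (cvg_shift (N + M)))|move=> n; case: (sp (n + (N + M))%N)].
move=> n; set m := (n + (N + M))%N => ne.
have [n1 n2] := splitting_norm SW ax xd (DI m) (sp m); split.
- exact: le_lt_trans ne.
- exact: le_lt_trans ne.
have Nm : (N <= m)%N by rewrite /m addnCA leq_addr.
have Mm : (M <= m)%N by rewrite /m addnA leq_addl.
have := splitting_rsum_cut SW g ax xd (DI m) (sp m) (JJJc m Nm).
have := Mw m Mm; rewrite /= lte_fin /err /split_error => + E.
by rewrite -E => /ltr_normlW; lra.
Unshelve. all: by end_near. Qed.

Lemma C_on_nondecreasing G x I e e' :
  e <= e' -> (C_on A B S g G x I e <= C_on A B S g G x I e')%E.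
Proof.
move=> ee'; rewrite /C_on ge_max !le_max lexx/=; apply/orP; right.
apply: le_ereal_sup => _ [D [D1 [D2 [I1 [I2 [J [J1 [J2 [C [GD DI De] GDs c ->]]]]]]]]].
exists D, D1, D2, I1, I2, J, J1, J2; split=> //; split=> //.
exact: lt_le_trans ee'.
Qed.

(** C(x;G;e) is less than w x for all small e, and bounds the error for every
    division of norm less than e that does not have x as a division-point. *)
Lemma cuts_near_norm (w : R -> R) (x : R) :
  (c_family A B S g (occurring F) x < (w x)%:E)%E ->
  cuts_near A B S F g (eq id) w x.
Proof.
move=> cw a d gax gxd.
have C := Sbar_itv_condition_a gax gxd.
have ax := Sbar_itv_lt gax; have xd := Sbar_itv_lt gxd; rewrite /= in ax xd.
have {cw}cw : (c_on A B S g (occurring F) x `[a, d]%classic < (w x)%:E)%E.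
  apply: le_lt_trans cw; apply: ereal_sup_ubound; exists `[a, d]%classic => //.
  by exists `[a, x]%classic, `[x, d]%classic.
near=> e => D FD DI.
have Cw : (C_on A B S g (occurring F) x `[a, d]%classic e < (w x)%:E)%E.
  near: e; apply: near_lim_at_right_lt cw => e e' _.
  exact: C_on_nondecreasing.
have w0 : 0 < w x.
  by rewrite -lte_fin; apply: le_lt_trans Cw; rewrite /C_on le_max lexx.
have [D1 [D2 [FD1 FD2 sp]]] := axiom_vi hF C FD DI.
exists id, D1, D2; split=> //; [by split=> // n; case: (sp n)..|].
move=> n ne; have [n1 n2] := splitting_norm SW ax xd (DI n) (sp n); split.
- exact: le_lt_trans ne.
- exact: le_lt_trans ne.
have [[Dn _]|[_ [J [J1 [J2 c]]]]] := splitting_cases SW ax xd (DI n) (sp n).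
  by rewrite (splitting_rsum_point SW g ax xd (sp n) Dn) lerDl ltW.
have : split_error g J J1 J2 < w x.
  rewrite -lte_fin; apply: le_lt_trans Cw; rewrite /C_on le_max; apply/orP; right.
  apply: ereal_sup_ubound.
  exists (D n), (D1 n), (D2 n), `[a, x]%classic, `[x, d]%classic, J, J1, J2.
  split=> //; split=> //.
  - by exists D => //; exists n.
  - by exists D1 => //; exists n.
  - by exists D2 => //; exists n.
rewrite /split_error -(splitting_rsum_cut SW g ax xd (DI n) (sp n) c).
by move=> /ltr_normlW; lra.
Unshelve. all: by end_near. Qed.

End Cuts.

(** * Approximating extended sums from above *)
Section Extended_sums.
Variable R : realType.
Local Open Scope ereal_scope.

(** All terms being nonnegative, a sum below a real number has only finite
    terms, and the slack can be distributed among them; half of what is left is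
    spent at each term. *)
Lemma sum_lt_approx (s : seq R) (c : R -> \bar R) (k : R) : uniq s ->
  (forall y, y \in s -> 0 <= c y) -> \sum_(y <- s) c y < k%:E ->
  exists w : R -> R, (forall y, y \in s -> c y < (w y)%:E) /\ (\sum_(y <- s) w y <= k)%R.
Proof.
elim: s k => [|x s IH] k.
  by rewrite big_nil lte_fin => _ _ k0; exists (fun=> 0%R); rewrite big_nil ltW.
move=> /= /andP[xs us] c0; rewrite big_cons.
have cs0 y : y \in s -> 0 <= c y by move=> ys; apply: c0; rewrite inE ys orbT.
have sum0 : 0 <= \sum_(y <- s) c y by rewrite big_seq; exact: sume_ge0.
have := c0 x (mem_head _ _); case E : (c x) => [cx| |//]; last first.
  by move=> _; rewrite addye ?gt_eqF ?(lt_le_trans _ sum0)//.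
move=> cx0.
case Es : (\sum_(y <- s) c y) sum0 => [cs| |//] sum0; last by rewrite addey.
rewrite -EFinD lte_fin => csk.
have [|w [wc ws]] := IH ((k - cx + cs) / 2)%R us cs0.
  by rewrite Es lte_fin; lra.
exists (fun y => if y == x then ((k + cx - cs) / 2)%R else w y); split.
  move=> y; rewrite inE; case: eqP => [-> _|_ /= ys]; last exact: wc.
  by rewrite E lte_fin; lra.
rewrite big_cons eqxx (eq_big_seq w); first by lra.
by move=> y ys; case: eqP => // yx; rewrite -yx ys in xs.
Qed.

(** With a and b different from -oo and c nonnegative, the sum on the right is
    +oo as soon as one of the terms is. *)
Lemma le_add3_approx (x a b c : \bar R) : a != -oo -> b != -oo -> 0 <= c ->
  (forall u v k : R, a < u%:E -> b < v%:E -> c < k%:E -> x <= (u + v + k)%:E) ->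
  x <= a + b + c.
Proof.
case: a b c => [a| |//] [b| |//] [c| |//] _ _ _ H; rewrite ?leey//.
rewrite -!EFinD; apply/lee_addgt0Pr => e e0; rewrite -EFinD.
apply: le_trans (H (a + e / 3) (b + e / 3) (c + e / 3) _ _ _)%R _;
  by rewrite ?lte_fin ?lee_fin; lra.
Qed.

Lemma limn_esup_le (u : nat -> \bar R) (w : \bar R) :
  (\forall n \near \oo, u n <= w) -> limn_esup u <= w.
Proof.
move=> uw; apply: (@le_trans _ _ (ereal_sup (u @` [set n | u n <= w]))).
  by apply: ereal_inf_lbound; exists [set n | u n <= w].
by apply: ge_ereal_sup => _ [n nw <-].
Qed.

End Extended_sums.

(** * Breaking up a succession over two sets *)
Section Pair_splitting.
Variables (R : realType) (A B : R) (S : set (interval R)).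
Hypothesis SW : S `<=` is_interval_of_W A B.
Variable F : set (nat -> {fset interval R}).
Hypothesis hF : burkill_family A B S F.
Variables X Y : set R.
Hypotheses (SX : Sbar A B S X) (SY : Sbar A B S Y) (XY : ~ overlap A B X Y).

(** Ensures that the sum over the union of divisions of X and of Y is the sum of
    the sums, also when the components of X and Y are interlaced. *)
Lemma nonoverlapping_disjoint D D' : division A B S X D -> division A B S Y D' ->
  forall J, J \in D -> J \in D' -> False.
Proof.
move=> DX DY J JD JD'; apply: XY.
have [lr AJ JB _ _] := interval_of_W_ends (division_W SW DX JD).
apply: (overlap_limit_points SX SY AJ lr JB) => x; rewrite /= in_itv/= => xJ.
  by apply: (division_sub SW DX JD); lra.
by apply: (division_sub SW DY JD'); lra.
Qed.

Definition splits_near (g : interval R -> R) (T : set (nat -> nat)) (k : R) : Prop :=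
  \forall e \near 0^'+, forall D, F D -> Defs.over A B S (X `|` Y) D ->
  exists s D1 D2, [/\ T s, F D1 /\ Defs.over A B S X D1, F D2 /\ Defs.over A B S Y D2 &
    forall n, norm (D (s n)) < e ->
      [/\ norm (D1 n) < e, norm (D2 n) < e &
        rsum g (D (s n)) <= rsum g (D1 n) + rsum g (D2 n) + k]].

(** The list s consists of the common frontier points; it is fixed before g and
    T, so that the same points serve all four inequalities.  Each of them has an
    interval of Sbar on either side, hence satisfies condition (a). *)
Lemma pair_splitting : exists s : seq R,
  [/\ uniq s, frontier A B X `&` frontier A B Y = [set` s],
    forall x, x \in s -> exists a d, Sbar_itv A B S (a, x) /\ Sbar_itv A B S (x, d) &
    forall g (T : set (nat -> nat)), T id ->
      (forall s s', T s -> T s' -> T (s \o s')) ->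
      (forall s, T s -> s n @[n --> \oo] --> \oo) ->
      forall w, (forall x, x \in s -> cuts_near A B S F g T w x) ->
      splits_near g T (\sum_(x <- s) w x)].
Proof.
have [LX [gLX sLX EX]] := Sbar_components SW SX.
have [LY [gLY sLY EY]] := Sbar_components SW SY.
have [L [LXY bL]] := merged_components SX SY XY gLX gLY sLX sLY EX EY.
have gL p : p \in L -> Sbar_itv A B S p.
  by rewrite (perm_mem LXY) mem_cat => /orP[/gLX|/gLY].
have ltL p : p \in L -> p.1 < p.2 by move=> /gL; exact: Sbar_itv_lt.
exists (shared L); split.
- by have [] := chain_uniq ltL bL.
- exact: (frontier_shared SX SY XY gLX gLY sLX sLY EX EY LXY).
- move=> x /sharedP[p [q [/gL gp /gL gq px qx]]]; exists p.1, q.2.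
  by move: gp gq; rewrite -{1}px -qx; case: p {px}; case: q {qx}.
move=> g T T_id T_comp T_cvg w cutL.
have nonempty Z LZ : Sbar A B S Z -> limit_point Z = covered LZ -> LZ != [::].
  move=> SZ EZ; apply/eqP => LZ0.
  have [z /(Sbar_subset_limit_point SZ)] := Sbar_nonempty SZ.
  by rewrite EZ LZ0 covered_nil.
have LX0 := nonempty _ _ SX EX; have LY0 := nonempty _ _ SY EY.
have L0 : L != [::].
  by apply/eqP => L0; move: (perm_size LXY); rewrite L0 size_cat; case: (LX) LX0.
have EXY : limit_point (X `|` Y) = limit_point (covered L).
  rewrite limit_pointU EX EY -covered_cat -(covered_perm LXY).
  by rewrite covered_limit_point.
have weak LZ : pairwise (@strictly_before R) LZ -> pairwise (@before R) LZ.
  by apply: sub_pairwise => p q; exact: ltW.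
have Eover Z LZ D : (forall p, p \in LZ -> Sbar_itv A B S p) -> limit_point Z = covered LZ ->
    Defs.over A B S (covered LZ) D -> Defs.over A B S Z D.
  move=> gZ EZ; apply: eq_over; rewrite EZ covered_limit_point// => p /gZ.
  exact: Sbar_itv_lt.
near=> e => D FD DXY.
have DL : Defs.over A B S (covered L) D by exact: (eq_over EXY DXY).
have [s [Ds [Ts FDs sD]]] : exists s (Ds : R * R -> nat -> {fset interval R}),
    [/\ T s,
    forall p, p \in L -> F (Ds p) /\ Defs.over A B S `[p.1, p.2]%classic (Ds p) &
    forall n, norm (D (s n)) < e ->
      (forall p, p \in L -> norm (Ds p n) < e) /\
      rsum g (D (s n)) <= \sum_(p <- L) rsum g (Ds p n) + \sum_(y <- shared L) w y].
  move: D FD DL {DXY}; near: e.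
  exact: (chain_splitting SW hF T_id T_comp T_cvg gL bL L0 cutL).
have XL p : p \in LX -> p \in L by rewrite (perm_mem LXY) mem_cat => ->.
have YL p : p \in LY -> p \in L by rewrite (perm_mem LXY) mem_cat orbC => ->.
have [D1 [FD1 D1X sum1 n1]] :=
  family_gather SW hF g gLX (weak _ sLX) LX0 (fun p pX => FDs p (XL p pX)).
have [D2 [FD2 D2Y sum2 n2]] :=
  family_gather SW hF g gLY (weak _ sLY) LY0 (fun p pY => FDs p (YL p pY)).
exists s, D1, D2; split=> //.
- by split=> //; exact: Eover gLX EX D1X.
- by split=> //; exact: Eover gLY EY D2Y.
move=> n ne; have [ne' gle] := sD n ne; split.
- by apply: n1 => p pX; apply: ne'; exact: XL.
- by apply: n2 => p pY; apply: ne'; exact: YL.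
- by rewrite sum1 sum2 -big_cat -(perm_big _ LXY).
Unshelve. all: by end_near. Qed.

End Pair_splitting.

(** * Changing the sign of g *)
Section Negation.
Variables (R : realType) (A B : R) (S : set (interval R)).
Variable F : set (nat -> {fset interval R}).
Variable g : interval R -> R.
Local Open Scope ereal_scope.

Lemma rsumN D : rsum (fun J => - g J)%R D = (- rsum g D)%R.
Proof. by rewrite /rsum sumrN. Qed.

Lemma split_errorN : split_error (fun J => - g J)%R = split_error g.
Proof.
apply/funext => J; apply/funext => J1; apply/funext => J2.
by rewrite /split_error -!opprD normrN.
Qed.

Lemma b_familyN x : b_family A B S (fun J => - g J)%R F x = b_family A B S g F x.
Proof. by rewrite /b_family /b_on /split_limsup split_errorN. Qed.

Lemma c_familyN G x : c_family A B S (fun J => - g J)%R G x = c_family A B S g G x.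
Proof. by rewrite /c_family /c_on /C_on split_errorN. Qed.

Lemma lower_integralN X :
  lower_integral A B S g F X = - upper_integral A B S (fun J => - g J)%R F X.
Proof.
rewrite /lower_integral /upper_integral /ereal_inf image_comp; congr (- ereal_sup _).
apply: eq_imagel => D _ /=; rewrite /limn_einf oppeK; congr limn_esup.
by apply/funext => n; rewrite rsumN EFinN.
Qed.

Lemma upper_norm_cvg G X :
  ereal_sup [set (rsum g D)%:E |
    D in [set D | [/\ G D, division A B S X D & (norm D < e)%R]]]
    @[e --> (0%R : R)^'+] --> upper_norm_limit A B S g G X.
Proof.
have ndf (e e' : R) : (0 < e)%R -> (e <= e')%R ->
    ereal_sup [set (rsum g D)%:E |
      D in [set D | [/\ G D, division A B S X D & (norm D < e)%R]]] <=
    ereal_sup [set (rsum g D)%:E |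
      D in [set D | [/\ G D, division A B S X D & (norm D < e')%R]]].
  move=> _ ee'; apply: ereal_sup_le => _ [D [GD DX De] <-]; exists D => //.
  by split=> //; exact: lt_le_trans ee'.
have H := lim_at_right_nondecreasing ndf.
by rewrite /upper_norm_limit (cvg_lim _ H).
Qed.

Lemma near_upper_norm_lt G X (w : \bar R) : upper_norm_limit A B S g G X < w ->
  \forall e \near (0%R : R)^'+, forall D, G D -> division A B S X D ->
    (norm D < e)%R -> (rsum g D)%:E < w.
Proof.
move=> /near_lim_at_right_lt H; apply: filterS (H _) => [e few D GD DX De|].
  by apply: le_lt_trans few; apply: ereal_sup_ubound; exists D.
move=> e e' _ ee'; apply: ereal_sup_le => _ [D [GD DX De] <-]; exists D => //.
by split=> //; exact: lt_le_trans ee'.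
Qed.

Lemma upper_norm_le G X (w : \bar R) :
  (\forall e \near (0%R : R)^'+, forall D, G D -> division A B S X D ->
    (norm D < e)%R -> (rsum g D)%:E <= w) ->
  upper_norm_limit A B S g G X <= w.
Proof.
move=> H; move: (@upper_norm_cvg G X); apply: cvge_le.
by apply: filterS H => e H; apply: ge_ereal_sup => _ [D [GD DX De] <-]; exact: H.
Qed.

End Negation.

Lemma lower_norm_limitN (R : realType) (A B : R) S (g : interval R -> R) G X :
  lower_norm_limit A B S g G X =
  (- upper_norm_limit A B S (fun J => - g J)%R G X)%E.
Proof.
have /cvgeN/cvg_lim <- // := @upper_norm_cvg R A B S (fun J => - g J) G X.
apply: (congr1 (fun f : R -> \bar R => lim (f e @[e --> (0 : R)^'+]))).
apply/funext => e /=.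
rewrite /ereal_inf image_comp; congr (- ereal_sup _)%E.
by apply: eq_imagel => D _ /=; rewrite rsumN EFinN.
Qed.

(** * Upper integrals and upper norm-limits *)
Section Upper_bounds.
Variables (R : realType) (A B : R) (S : set (interval R)).
Hypothesis SW : S `<=` is_interval_of_W A B.
Variable F : set (nat -> {fset interval R}).
Hypothesis hF : burkill_family A B S F.
Local Open Scope ereal_scope.

(** If all upper limits over X are -oo, a succession over X can be reindexed so
    that, added to a given one over Y, it makes the sums tend to -oo. *)
Lemma upper_integral_gtNy g X Y :
  Sbar A B S X -> Sbar A B S Y -> ~ overlap A B X Y ->
  lower_integral A B S g F (X `|` Y) != -oo -> upper_integral A B S g F X != -oo.
Proof.
move=> SX SY XY; apply: contra_neq => uX.
have [D1 FD1 D1X] := axiom_i hF SX; have [D2 FD2 D2Y] := axiom_i hF SY.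
have lim1 : limn_esup (fun n => (rsum g (D1 n))%:E) = -oo.
  apply/eqP; rewrite -leeNy_eq -uX; apply: ereal_sup_ubound.
  by exists D1.
(* s n is at least n, and so large that the sum over X outweighs D2 n by n *)
have /choice[s sP] : forall n : nat, exists k, (n <= k)%N /\
    (rsum g (D1 k) < - n%:R - rsum g (D2 n))%R.
  move=> n; have : limn_esup (fun n => (rsum g (D1 n))%:E)
      < (- n%:R - rsum g (D2 n))%:E by rewrite lim1 ltNyr.
  move=> /limn_esup_lt[N _ NP]; exists (maxn n N); split; first exact: leq_maxl.
  by rewrite -lte_fin; apply: NP; exact: leq_maxr.
have soo : s n @[n --> \oo] --> \oo.
  move=> V [N _ NV]; exists N => // n /= Nn; apply: NV => /=.
  by apply: leq_trans Nn _; have [] := sP n.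
have D1sX : Defs.over A B S X (fun n => D1 (s n)) by move=> n; exact: D1X.
have [FU UXY] := family_union hF SX SY XY (axiom_ii hF FD1 soo) FD2 D1sX D2Y.
apply: eq_ninfty => M.
apply: (@le_trans _ _ (limn_einf (fun n => (rsum g (D1 (s n) `|` D2 n)%fset)%:E))).
  by apply: ereal_inf_lbound; exists (fun n => D1 (s n) `|` D2 n)%fset.
apply: le_trans (limn_einf_sup _) _; apply: limn_esup_le.
near=> n; rewrite lee_fin rsum_fsetU; last first.
  exact: (nonoverlapping_disjoint SW SX SY XY (D1X _) (D2Y _)).
have [_ /ltW] := sP n; have : (- M <= n%:R)%R by near: n; exact: nbhs_infty_ger.
lra.
Unshelve. all: by end_near. Qed.

(** For divisions of small norm the sums of g over X + Y are bounded below.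
    Against one fixed division of Y, this bounds the sums over X from below. *)
Lemma upper_norm_gtNy g X Y :
  Sbar A B S X -> Sbar A B S Y -> ~ overlap A B X Y ->
  lower_norm_limit A B S g (occurring F) (X `|` Y) != -oo ->
  upper_norm_limit A B S g (occurring F) X != -oo.
Proof.
move=> SX SY XY; rewrite lower_norm_limitN eqe_oppLR /= => uXY; apply/eqP => uX.
have [M uM] : exists M : R, upper_norm_limit A B S (fun J => - g J)%R (occurring F)
    (X `|` Y) < M%:E.
  case: upper_norm_limit uXY => [r| |]// _.
    by exists (r + 1)%R; rewrite lte_fin ltrDl.
  by exists 0%R; rewrite ltNyr.
have [D1 FD1 D1X] := axiom_i hF SX; have [D2 FD2 D2Y] := axiom_i hF SY.
have [e [e0 eM]] : exists e : R, (0 < e)%R /\ forall D, occurring F D ->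
    division A B S (X `|` Y) D -> (norm D < e)%R ->
    (rsum (fun J => - g J)%R D)%:E < M%:E.
  apply: (@filter_ex _ (0%R : R)^'+); near=> e; split.
    by near: e; exact: nbhs_right_gt.
  by near: e; exact: near_upper_norm_lt uM.
have [N2 n2] : exists n, (norm (D2 n) < e)%R.
  apply: (@filter_ex _ \oo); exact: (family_norm_lt hF FD2 e0).
have [e' [e'0 e'M]] : exists e' : R, (0 < e')%R /\ forall D, occurring F D ->
    division A B S X D -> (norm D < e')%R ->
    (rsum g D)%:E < (- M - rsum g (D2 N2))%:E.
  apply: (@filter_ex _ (0%R : R)^'+); near=> e'; split.
    by near: e'; exact: nbhs_right_gt.
  by near: e'; apply: near_upper_norm_lt; rewrite uX ltNyr.
have [N1 n1] : exists n, (norm (D1 n) < Num.min e e')%R.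
  apply: (@filter_ex _ \oo); apply: (family_norm_lt hF FD1).
  by rewrite lt_min e0.
move: n1; rewrite lt_min => /andP[n1 n1'].
(* shifting both successions brings the two chosen divisions to the index 0,
   where their union occurs in the family *)
have D1s : Defs.over A B S X (fun n => D1 (n + N1)%N) by move=> n; exact: D1X.
have D2s : Defs.over A B S Y (fun n => D2 (n + N2)%N) by move=> n; exact: D2Y.
have [FU UXY] := family_union hF SX SY XY (axiom_ii hF FD1 (cvg_shift N1))
  (axiom_ii hF FD2 (cvg_shift N2)) D1s D2s.
have := eM (D1 N1 `|` D2 N2)%fset _ (UXY 0%N) (norm_fsetU n1 n2).
rewrite rsumN rsum_fsetU; last first.
  exact: (nonoverlapping_disjoint SW SX SY XY (D1X _) (D2Y _)).
have := e'M (D1 N1) _ (D1X _) n1'.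
rewrite !lte_fin => /(_ _)/wrap[]; first by exists D1 => //; exists N1.
move=> ? /(_ _)/wrap[]; last by lra.
by exists (fun n => D1 (n + N1) `|` D2 (n + N2))%N%fset => //; exists 0%N.
Unshelve. all: by end_near. Qed.

Section Pair.
Variables (g : interval R -> R) (X Y : set R).
Hypotheses (SX : Sbar A B S X) (SY : Sbar A B S Y) (XY : ~ overlap A B X Y).

Let Z := frontier A B X `&` frontier A B Y.

Let YX : ~ overlap A B Y X.
Proof. by move=> [J WJ JYX]; apply: XY; exists J; rewrite // setIC. Qed.

Lemma b_family_ge0 a x d : Sbar_itv A B S (a, x) -> Sbar_itv A B S (x, d) ->
  0 <= b_family A B S g F x.
Proof.
move=> gax gxd; apply: (@le_trans _ _ (b_on A B S g F x `[a, d]%classic)).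
  by rewrite /b_on le_max lexx.
apply: ereal_sup_ubound; exists `[a, d]%classic => //.
by exists `[a, x]%classic, `[x, d]%classic; exact: Sbar_itv_condition_a.
Qed.

Lemma c_family_ge0 G a x d : Sbar_itv A B S (a, x) -> Sbar_itv A B S (x, d) ->
  0 <= c_family A B S g G x.
Proof.
move=> gax gxd; apply: (@le_trans _ _ (c_on A B S g G x `[a, d]%classic)).
  have ndC (e e' : R) : (0 < e)%R -> (e <= e')%R -> _ :=
    fun _ => @C_on_nondecreasing _ A B S g G x `[a, d]%classic e e'.
  rewrite /c_on (cvg_lim _ (lim_at_right_nondecreasing ndC))//.
  by apply: le_ereal_inf_tmp => _ [e _ <-]; rewrite /C_on le_max lexx.
apply: ereal_sup_ubound; exists `[a, d]%classic => //.
by exists `[a, x]%classic, `[x, d]%classic; exact: Sbar_itv_condition_a.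
Qed.

(** Suppose that the upper limit along D exceeds u + v + k, where u, v and k
    exceed the upper integrals over X and Y and the sum of the b(y).  A
    subsequence along which all sums exceed this number is broken up by
    [pair_splitting]; its two parts have sums eventually below u and v, which
    is a contradiction. *)
Lemma upper_integral_le :
  lower_integral A B S g F (X `|` Y) != -oo ->
  [/\ upper_integral A B S g F X != -oo, upper_integral A B S g F Y != -oo,
    0 <= \sum_(y \in Z) b_family A B S g F y &
    upper_integral A B S g F (X `|` Y) <=
      upper_integral A B S g F X + upper_integral A B S g F Y
      + \sum_(y \in Z) b_family A B S g F y].
Proof.
move=> lXY.
have uX := upper_integral_gtNy SX SY XY lXY.
have uY : upper_integral A B S g F Y != -oo.
  by move: lXY; rewrite setUC; exact: upper_integral_gtNy.
have [s [us EZ gs split_s]] := pair_splitting SW hF SX SY XY.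
have b0 x : x \in s -> 0 <= b_family A B S g F x.
  by move=> /gs[a [d [gax gxd]]]; exact: b_family_ge0 gax gxd.
rewrite /Z EZ -fsbig_seq//.
have sum0 : 0 <= \sum_(x <- s) b_family A B S g F x by rewrite big_seq; exact: sume_ge0.
split=> //; apply: le_add3_approx => // u v k Xu Yv bk.
have [w [bw wk]] := sum_lt_approx us b0 bk.
apply: ge_ereal_sup => _ [D [FD DXY] <-]; rewrite leNgt; apply/negP => uD.
have [s0 [s0oo s0D]] := subsequence (lt_limn_esup uD).
have FDs := axiom_ii hF FD s0oo.
have DsXY : Defs.over A B S (X `|` Y) (fun n => D (s0 n)) by move=> n; exact: DXY.
have spl : splits_near A B S F X Y g to_infinity (\sum_(x <- s) w x).
  apply: (split_s g to_infinity to_infinity_id to_infinity_comp (fun _ => id)).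
  by move=> x xs; exact: (cuts_near_family SW hF (bw x xs)).
have [e [e0 eD]] := filter_ex (filterI (nbhs_right_gt (0%R : R)) spl).
have [s1 [D1 [D2 [s1oo [FD1 D1X] [FD2 D2Y] sD]]]] := eD _ FDs DsXY.
have FDss := axiom_ii hF FDs s1oo.
have near1 : \forall n \near \oo, (rsum g (D1 n))%:E < u%:E.
  apply: limn_esup_lt; apply: le_lt_trans Xu; apply: ereal_sup_ubound.
  by exists D1.
have near2 : \forall n \near \oo, (rsum g (D2 n))%:E < v%:E.
  apply: limn_esup_lt; apply: le_lt_trans Yv; apply: ereal_sup_ubound.
  by exists D2.
have [n [[n1 n2] nD]] :=
  filter_ex (filterI (filterI near1 near2) (family_norm_lt hF FDss e0)).
have [_ _] := sD n nD; have := s0D (s1 n).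
by move: n1 n2; rewrite !lte_fin; lra.
Qed.

(** A division of small norm in G is the n-th term of a succession of F;
    [pair_splitting] without reindexing breaks it up into divisions in G of norm
    as small, for which the bounds u and v hold. *)
Lemma upper_norm_limit_le (G := occurring F) :
  lower_norm_limit A B S g G (X `|` Y) != -oo ->
  [/\ upper_norm_limit A B S g G X != -oo, upper_norm_limit A B S g G Y != -oo,
    0 <= \sum_(y \in Z) c_family A B S g G y &
    upper_norm_limit A B S g G (X `|` Y) <=
      upper_norm_limit A B S g G X + upper_norm_limit A B S g G Y
      + \sum_(y \in Z) c_family A B S g G y].
Proof.
move=> lXY.
have uX := upper_norm_gtNy SX SY XY lXY.
have uY : upper_norm_limit A B S g G Y != -oo.
  by move: lXY; rewrite setUC; exact: upper_norm_gtNy.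
have [s [us EZ gs split_s]] := pair_splitting SW hF SX SY XY.
have c0 x : x \in s -> 0 <= c_family A B S g G x.
  by move=> /gs[a [d [gax gxd]]]; exact: c_family_ge0 gax gxd.
rewrite /Z EZ -fsbig_seq//.
have sum0 : 0 <= \sum_(x <- s) c_family A B S g G x by rewrite big_seq; exact: sume_ge0.
split=> //; apply: le_add3_approx => // u v k Xu Yv ck.
have [w [cw wk]] := sum_lt_approx us c0 ck.
have spl : splits_near A B S F X Y g (eq id) (\sum_(x <- s) w x).
  apply: split_s => //; [by move=> ? ? <- <-|by move=> ? <-; exact: cvg_id|].
  by move=> x xs; exact: (cuts_near_norm SW hF (cw x xs)).
apply: upper_norm_le.
apply: filterS (filterI (filterI (near_upper_norm_lt Xu) (near_upper_norm_lt Yv)) spl).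
move=> e [[eX eY] eD] _ [D FD [n ->]] DnXY Dne.
have [_ [D1 [D2 [<- [FD1 D1X] [FD2 D2Y] sD]]]] := eD D FD (family_over_one hF FD DnXY).
have [n1 n2] := sD n Dne.
have G1 : G (D1 n) by exists D1 => //; exists n.
have G2 : G (D2 n) by exists D2 => //; exists n.
have := eX _ G1 (D1X n) n1; have := eY _ G2 (D2Y n) n2.
by rewrite !lte_fin lee_fin; move: wk; lra.
Qed.

End Pair.
End Upper_bounds.

Lemma oppe_add3_le (R : realType) (x a b c : \bar R) :
  (a != -oo -> b != -oo -> 0 <= c -> x <= a + b + c -> - a + - b - c <= - x)%E.
Proof.
case: a b c => [a| |//] [b| |//] [c| |//] _ _ _ /=; rewrite ?leNye//.
by rewrite -!EFinD -!opprD EFinN leeN2.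
Qed.

Local Open Scope ereal_scope.

Theorem mainTheorem4 (R : realType) (A B : R) (hAB : (A < B)%R)
    (S : set (interval R)) (hS0 : S !=set0) (hS : S `<=` is_interval_of_W A B)
    (g : interval R -> R)
    (F : set (nat -> {fset interval R})) (hF : burkill_family A B S F)
    (R1 R2 : set R) (hR1 : Sbar A B S R1) (hR2 : Sbar A B S R2)
    (hR12 : ~ overlap A B R1 R2) :
  let R3 := R1 `|` R2 in
  let G := occurring F in
  let Y := frontier A B R1 `&` frontier A B R2 in
  (upper_integral A B S g F R3 \is a fin_num ->
   lower_integral A B S g F R3 \is a fin_num ->
   upper_integral A B S g F R3 <=
     upper_integral A B S g F R1 + upper_integral A B S g F R2
     + \sum_(y \in Y) b_family A B S g F y /\
   lower_integral A B S g F R3 >=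
     lower_integral A B S g F R1 + lower_integral A B S g F R2
     - \sum_(y \in Y) b_family A B S g F y) /\
  (upper_norm_limit A B S g G R3 \is a fin_num ->
   lower_norm_limit A B S g G R3 \is a fin_num ->
   upper_norm_limit A B S g G R3 <=
     upper_norm_limit A B S g G R1 + upper_norm_limit A B S g G R2
     + \sum_(y \in Y) c_family A B S g G y /\
   lower_norm_limit A B S g G R3 >=
     lower_norm_limit A B S g G R1 + lower_norm_limit A B S g G R2
     - \sum_(y \in Y) c_family A B S g G y).
Proof.
move=> R3 G Y; pose g' J := (- g J)%R.
have g'K : (fun J => - g' J)%R = g by apply/funext => J; rewrite /g' opprK.
split=> ufin lfin; split.
- have lR3 : lower_integral A B S g F R3 != -oo by move: lfin; rewrite fin_numE => /andP[].
  by have [_ _ _] := upper_integral_le hS hF hR1 hR2 hR12 lR3.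
- have lR3 : lower_integral A B S g' F R3 != -oo.
    rewrite lower_integralN g'K eqe_oppLR /=.
    by move: ufin; rewrite fin_numE => /andP[].
  have [u1 u2 b0 le3] := upper_integral_le hS hF hR1 hR2 hR12 lR3.
  have E : \sum_(y \in Y) b_family A B S g' F y = \sum_(y \in Y) b_family A B S g F y.
    by apply: eq_fsbigr => y _; exact: b_familyN.
  rewrite !lower_integralN -E; exact: (oppe_add3_le u1 u2 b0 le3).
- have lR3 : lower_norm_limit A B S g G R3 != -oo by move: lfin; rewrite fin_numE => /andP[].
  by have [_ _ _] := upper_norm_limit_le hS hF hR1 hR2 hR12 lR3.
- have lR3 : lower_norm_limit A B S g' G R3 != -oo.
    rewrite lower_norm_limitN g'K eqe_oppLR /=.
    by move: ufin; rewrite fin_numE => /andP[].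
  have [u1 u2 c0 le3] := upper_norm_limit_le hS hF hR1 hR2 hR12 lR3.
  have E : \sum_(y \in Y) c_family A B S g' G y = \sum_(y \in Y) c_family A B S g G y.
    by apply: eq_fsbigr => y _; exact: c_familyN.
  rewrite !lower_norm_limitN -E; exact: (oppe_add3_le u1 u2 c0 le3).
Qed.
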